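(* Let $L$ be a line bundle on a projective variety $Y$ over $k$, and let $s\in H^0(Y,L^{\otimes d})$ be a nonzero section such that $s=a_1\otimes a_2\otimes\cdots\otimes a_d$ with $a_i\in H^0(Y,L)$ for each $1\le i\le d$. Let $\pi\colon X\to Y$ be the corresponding standard cyclic covering (of projective varieties) of degree $d$ branched over the divisor of $s$. Then there exists a relatively Ulrich coherent sheaf of rank $1$ on $X$ with respect to $\pi$.
   Context: $k$ is an algebraically closed field of characteristic zero; a variety is an integral separated scheme of finite type over $k$. Relatively Ulrich sheaf: for a finite morphism $\pi\colon X\to Y$ of projective varieties, a coherent sheaf $E$ on $X$ is relatively Ulrich with respect to $\pi$ if $\pi_*E\cong\mathcal{O}_Y^{\oplus r}$ for some positive integer $r$. Standard cyclic cover: a ramified cyclic Galois cover $\pi\colon X\to Y$ of degree $d$ (i.e. $Y=X/(\mathbb{Z}/d\mathbb{Z})$ for a faithful action, $\pi$ the quotient map) with $\pi_*\mathcal{O}_X\cong\mathcal{O}_Y\oplus L^{-1}\oplus\cdots\oplus L^{1-d}$ for a line bundle $L$ on $Y$. Its branch divisor is $Z(s)$ for a nonzero section $s\in H^0(Y,L^{\otimes d})$, and $X$ is the closed subscheme $\{t^d=s\}$ of the total space of $L$, with $t$ the tautological section of the pullback of $L$; the cover is determined by $(s,L)$. Here $a_1\otimes\cdots\otimes a_d$ denotes the product section of $L^{\otimes d}$. *)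

(* Defs.v *)
From HB Require Import structures.
From mathcomp Require Import all_boot all_order all_algebra.
From mathcomp Require Import boolp classical_sets functions topology.

Set Implicit Arguments.
Unset Strict Implicit.
Unset Printing Implicit Defensive.
Import GRing.Theory.
Local Open Scope classical_set_scope.
Local Open Scope ring_scope.

Identity Coercion set_to_fun : set >-> Funclass.

Record opens (X : topologicalType) := Opens {
  oset :> set X;
  oset_open : open oset
}.

Definition otop (X : topologicalType) : opens X := Opens openT.

Definition preim (X Y : topologicalType) (f : continuousType X Y)
    (V : opens Y) : opens X :=
  Opens (open_comp (fun x _ => @cts_fun _ _ f x) (oset_open V)).

(* The index type of a covering may be empty, so that a sheaf has exactly one
   section over the empty set. *)
Definition is_sheaf (X : topologicalType) (F : opens X -> Type)
    (r : forall U V : opens X, V `<=` U -> F U -> F V) : Prop :=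
  [/\ forall (U : opens X) (UU : U `<=` U) (s : F U), r U U UU s = s,
      forall (U V W : opens X) (VU : V `<=` U) (WV : W `<=` V) (WU : W `<=` U)
        (s : F U), r V W WV (r U V VU s) = r U W WU s
    & forall (U : opens X) (I : Type) (V : I -> opens X)
        (VU : forall i, V i `<=` U),
        (forall x, U x -> exists i, V i x) ->
        forall s : forall i, F (V i),
        (forall i j (W : opens X) (Wi : W `<=` V i) (Wj : W `<=` V j),
            r (V i) W Wi (s i) = r (V j) W Wj (s j)) ->
        exists! t : F U, forall i, r U (V i) (VU i) t = s i].

(* Sections over the empty set form the zero ring, hence comPzRingType.  The
   ring morphism [kstr] from the base field is the structure morphism of the
   space to Spec k. *)
Record ringed_space (k : fieldType) := RingedSpace {
  pts :> topologicalType;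
  sec : opens pts -> comPzRingType;
  res : forall U V : opens pts, V `<=` U -> {rmorphism sec U -> sec V};
  res_sheaf : is_sheaf (fun U V VU => res VU);
  kstr : {rmorphism k -> sec (otop pts)}
}.
Arguments sec {k} _ _.
Arguments res {k r U V} _.

Definition const (k : fieldType) (X : ringed_space k) (U : opens X) (c : k) :
    sec X U :=
  res (@subsetT _ U : U `<=` otop X) (kstr X c).

(* The germ of f at x is a unit of the stalk O_{X,x}. *)
Definition unit_at (k : fieldType) (X : ringed_space k) (U : opens X)
    (f : sec X U) (x : X) : Prop :=
  exists (V : opens X) (VU : V `<=` U), V x /\ exists g, res VU f * g = 1.

(* Every stalk is a local ring: 0 is not a unit and the non-units are closed
   under addition (two germs have representatives on a common open set). *)
Definition locally_ringed (k : fieldType) (X : ringed_space k) : Prop :=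
  forall x : X, ~ unit_at (0 : sec X (otop X)) x /\
    forall (U : opens X) (f g : sec X U), U x ->
      unit_at (f + g) x -> unit_at f x \/ unit_at g x.

Lemma unit_at_open (k : fieldType) (X : ringed_space k) (U : opens X)
  (f : sec X U) : open [set x | unit_at f x].
Proof.
rewrite openE => x [V [VU [Vx fV]]]; rewrite /interior /= nbhsE.
by exists V => // [|y Vy]; [split=> //; exact: oset_open|exists V, VU].
Qed.

Definition basic_open (k : fieldType) (X : ringed_space k) (U : opens X)
    (f : sec X U) : opens X := Opens (unit_at_open f).

Lemma basic_open_sub (k : fieldType) (X : ringed_space k) (U : opens X)
  (f : sec X U) : basic_open f `<=` U.
Proof. by move=> x [V [VU [/VU]]]. Qed.

Definition prime_ideal (R : comPzRingType) (P : set R) : Prop :=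
  [/\ P 0, forall a b, P a -> P b -> P (a + b),
      forall a b, P b -> P (a * b), ~ P 1
    & forall a b, P (a * b) -> P a \/ P b].

(* The canonical morphism (U, O_X|U) -> Spec O_X(U), which sends x to the prime
   ideal of the f whose germ at x is not a unit, is an isomorphism: it is
   bijective, a homeomorphism (the preimages of the principal open sets are the
   [basic_open f] and form a basis of U), and O_X(U)_f -> O_X(basic_open f) is
   bijective for every f. *)
Definition affine (k : fieldType) (X : ringed_space k) (U : opens X) : Prop :=
  [/\ forall P : set (sec X U), prime_ideal P ->
        exists! x : X, U x /\ forall f, P f <-> ~ unit_at f x,
      forall (W : opens X) (x : X), W `<=` U -> W x ->
        exists f : sec X U, basic_open f x /\ basic_open f `<=` W
    & forall f : sec X U,
        (forall a, res (@basic_open_sub _ _ _ f) a = 0 ->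
           exists n, f ^+ n * a = 0) /\
        (forall b, exists n a,
           res (@basic_open_sub _ _ _ f) (f ^+ n) * b
           = res (@basic_open_sub _ _ _ f) a)].

Definition is_scheme (k : fieldType) (X : ringed_space k) : Prop :=
  locally_ringed X /\ forall x : X, exists U : opens X, U x /\ affine U.

Definition integral (k : fieldType) (X : ringed_space k) : Prop :=
  (exists x : X, True) /\
  forall U : opens X, U !=set0 ->
    (1 : sec X U) != 0 /\
    forall f g : sec X U, f * g = 0 -> f = 0 \/ g = 0.

(* Morphisms of locally ringed spaces over k. *)
Record rs_hom (k : fieldType) (X Y : ringed_space k) := RsHom {
  hfun :> continuousType X Y;
  comor : forall V : opens Y, {rmorphism sec Y V -> sec X (preim hfun V)};
  comor_nat : forall (V V' : opens Y) (V'V : V' `<=` V)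
    (VV : preim hfun V' `<=` preim hfun V) (a : sec Y V),
    comor V' (res V'V a) = res VV (comor V a);
  comor_local : forall (V : opens Y) (a : sec Y V) (x : X), V (hfun x) ->
    unit_at (comor V a) x -> unit_at a (hfun x);
  comor_k : forall (V : opens Y) (c : k),
    comor V (const V c) = const (preim hfun V) c
}.
Arguments comor {k X Y} _ _.

(* h = g o f *)
Definition is_comp (k : fieldType) (X Y Z : ringed_space k)
    (f : rs_hom X Y) (g : rs_hom Y Z) (h : rs_hom X Z) : Prop :=
  (forall x, h x = g (f x)) /\
  forall (W : opens Z) (a : sec Z W) (U : opens X)
    (Uh : U `<=` preim h W) (Uf : U `<=` preim f (preim g W)),
    res Uh (comor h W a) = res Uf (comor f _ (comor g W a)).

Definition is_id (k : fieldType) (X : ringed_space k) (f : rs_hom X X) : Prop :=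
  (forall x, f x = x) /\
  forall (V : opens X) (a : sec X V) (U : opens X)
    (Uf : U `<=` preim f V) (UV : U `<=` V),
    res Uf (comor f V a) = res UV a.

Definition affine_morphism (k : fieldType) (X Y : ringed_space k)
    (f : rs_hom X Y) : Prop :=
  forall V : opens Y, affine V -> affine (preim f V).

Definition finite_morphism (k : fieldType) (X Y : ringed_space k)
    (f : rs_hom X Y) : Prop :=
  affine_morphism f /\
  forall V : opens Y, affine V ->
    exists (n : nat) (b : 'I_n -> sec X (preim f V)),
      forall g, exists c : 'I_n -> sec Y V,
        g = \sum_(i < n) comor f V (c i) * b i.

Definition closed_immersion (k : fieldType) (X Y : ringed_space k)
    (f : rs_hom X Y) : Prop :=
  affine_morphism f /\
  forall V : opens Y, affine V ->
    forall b : sec X (preim f V), exists a, comor f V a = b.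

(* P is glued in the usual way from the affine spaces
   U i = Spec k[x i j, j != i], where x i j stands for X_j / X_i: the section
   ring of U i is the polynomial ring in the n variables x i j (the monomials
   in them form a k-basis), and U i and U j overlap in the locus where x i j is
   invertible, with x i l = x i j * x j l. *)
Definition is_projective_space (k : fieldType) (n : nat) (P : ringed_space k) :
    Prop :=
  is_scheme P /\
  exists (U : 'I_n.+1 -> opens P) (x : forall i, 'I_n.+1 -> sec P (U i)),
  let mon i N (m : {ffun 'I_n -> 'I_N}) :=
    \prod_(j < n) x i (lift i j) ^+ m j in
  [/\ forall p : P, exists i, U i p,
      forall i, affine (U i) /\ x i i = 1,
      forall i (f : sec P (U i)),
        exists (N : nat) (c : {ffun 'I_n -> 'I_N} -> k),
          f = \sum_(m : {ffun 'I_n -> 'I_N}) const (U i) (c m) * mon i N m,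
      forall i (N : nat) (c : {ffun 'I_n -> 'I_N} -> k),
        \sum_(m : {ffun 'I_n -> 'I_N}) const (U i) (c m) * mon i N m = 0 ->
        forall m, c m = 0
    & forall i j,
        (forall p, U i p /\ U j p <-> unit_at (x i j) p) /\
        forall l (W : opens P) (Wi : W `<=` U i) (Wj : W `<=` U j),
          res Wi (x i l) = res Wi (x i j) * res Wj (x j l)].

(* A closed subscheme of a projective space is automatically separated and of
   finite type over k. *)
Definition projective_variety (k : fieldType) (X : ringed_space k) : Prop :=
  [/\ is_scheme X, integral X
    & exists (n : nat) (P : ringed_space k) (i : rs_hom X P),
        is_projective_space n P /\ closed_immersion i].

Record modsheaf (k : fieldType) (X : ringed_space k) := ModSheaf {
  msec : forall U : opens X, lmodType (sec X U);
  mres : forall U V : opens X, V `<=` U -> {additive msec U -> msec V};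
  mresZ : forall (U V : opens X) (VU : V `<=` U) (a : sec X U) (m : msec U),
    mres VU (a *: m) = res VU a *: mres VU m;
  mres_sheaf : is_sheaf (fun U V VU => mres VU)
}.
Arguments msec {k X} _ _.
Arguments mres {k X M U V} _ : rename.

Record mhom (k : fieldType) (X : ringed_space k) (M N : modsheaf X) := MHom {
  mfun :> forall U : opens X, {linear msec M U -> msec N U};
  mfun_nat : forall (U V : opens X) (VU : V `<=` U) (m : msec M U),
    mfun V (mres VU m) = mres VU (mfun U m)
}.

Definition mod_iso (k : fieldType) (X : ringed_space k) (M N : modsheaf X) :
    Prop :=
  exists f : mhom M N, forall U, bijective (f U).

Definition restr_scal (R S : pzRingType) (f : {rmorphism R -> S})
    (M : lmodType S) : Type := M.
HB.instance Definition _ (R S : pzRingType) (f : {rmorphism R -> S})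
  (M : lmodType S) := GRing.Zmodule.copy (restr_scal f M) M.

Section RestrScal.
Context (R S : pzRingType) (f : {rmorphism R -> S}) (M : lmodType S).
Implicit Types (a b : R) (m : restr_scal f M).

Definition rs_scale a m : restr_scal f M := f a *: (m : M).

Lemma rs_scaleA a b m : rs_scale a (rs_scale b m) = rs_scale (a * b) m.
Proof. by rewrite /rs_scale scalerA rmorphM. Qed.

Lemma rs_scale1 : left_id 1 rs_scale.
Proof. by move=> m; rewrite /rs_scale rmorph1 scale1r. Qed.

Lemma rs_scaleDr : right_distributive rs_scale +%R.
Proof. by move=> a m m'; rewrite /rs_scale scalerDr. Qed.

Lemma rs_scaleDl m : {morph rs_scale^~ m : a b / a + b}.
Proof. by move=> a b; rewrite /rs_scale rmorphD scalerDl. Qed.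

HB.instance Definition _ := GRing.Zmodule_isLmodule.Build R (restr_scal f M)
  rs_scaleA rs_scale1 rs_scaleDr rs_scaleDl.
End RestrScal.

Lemma preimS (X Y : topologicalType) (f : continuousType X Y)
  (U V : opens Y) : V `<=` U -> preim f V `<=` preim f U.
Proof. by move=> VU x /VU. Qed.

Section Pushforward.
Context (k : fieldType) (X Y : ringed_space k) (f : rs_hom X Y) (E : modsheaf X).

Definition push_sec (V : opens Y) : lmodType (sec Y V) :=
  restr_scal (comor f V) (msec E (preim f V)).

Definition push_res (U V : opens Y) (VU : V `<=` U) :
    {additive push_sec U -> push_sec V} :=
  (mres (preimS (f := f) VU) :
    {additive msec E (preim f U) -> msec E (preim f V)}).

Lemma push_resZ (U V : opens Y) (VU : V `<=` U) (a : sec Y U)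
  (m : push_sec U) : push_res VU (a *: m) = res VU a *: push_res VU m.
Proof.
rewrite [LHS](mresZ (preimS (f := f) VU) (comor f U a) m).
by rewrite -(comor_nat VU (preimS (f := f) VU)).
Qed.

Lemma push_sheaf : is_sheaf (fun U V VU => push_res VU).
Proof.
have [Eid Ecomp Eglue] := mres_sheaf E; split.
- by move=> U UU s; exact: Eid.
- by move=> U V W VU WV WU s; exact: Ecomp.
move=> U I V VU Ucov s s_compat.
apply: (Eglue (preim f U) I (fun i => preim f (V i))) => [x /Ucov[i Vx]|].
  by exists i.
move=> i j W Wi Wj.
pose Vij := Opens (openI (oset_open (V i)) (oset_open (V j))).
have Vi : Vij `<=` V i by move=> y [].
have Vj : Vij `<=` V j by move=> y [].
have WV : W `<=` preim f Vij by move=> x Wx; split; [exact: Wi|exact: Wj].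
have := s_compat i j Vij Vi Vj.
move=> /(congr1 (mres WV : msec E (preim f Vij) -> msec E W)).
by rewrite !(Ecomp _ _ _ _ _ Wi) !(Ecomp _ _ _ _ _ Wj).
Qed.

Definition pushforward : modsheaf Y :=
  ModSheaf push_resZ push_sheaf.
End Pushforward.

Section FreeModule.
Context (k : fieldType) (X : ringed_space k) (r : nat).

Definition free_sec (U : opens X) : lmodType (sec X U) := 'rV[sec X U]_r.

Definition free_res (U V : opens X) (VU : V `<=` U) :
    {additive free_sec U -> free_sec V} :=
  (map_mx (res VU) : {additive 'rV_r -> 'rV_r}).

Lemma free_resZ (U V : opens X) (VU : V `<=` U) (a : sec X U)
  (m : free_sec U) : free_res VU (a *: m) = res VU a *: free_res VU m.
Proof. exact: map_mxZ. Qed.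

Lemma free_sheaf : is_sheaf (fun U V VU => free_res VU).
Proof.
have [Oid Ocomp Oglue] := res_sheaf X; split.
- by move=> U UU s; apply/rowP => i; rewrite mxE; exact: Oid.
- by move=> U V W VU WV WU s; apply/rowP => i; rewrite !mxE; exact: Ocomp.
move=> U I V VU Ucov s s_compat.
have glue (l : 'I_r) : exists! t, forall i, res (VU i) t = s i 0 l.
  apply: Oglue => // i j W Wi Wj.
  by have /rowP/(_ l) := s_compat i j W Wi Wj; rewrite !mxE.
have [t tP] := choice glue.
exists (\row_l t l); split => [i|t' t'P].
  by apply/rowP => l; rewrite !mxE; exact: (proj1 (tP l)).
apply/rowP => l; rewrite mxE; apply: (proj2 (tP l)) => i.
by rewrite -t'P [RHS]mxE.
Qed.

Definition free_mod : modsheaf X := ModSheaf free_resZ free_sheaf.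
End FreeModule.
Arguments free_mod {k} X r.

Section StructureSheaf.
Context (k : fieldType) (X : ringed_space k).

Definition struct_sec (U : opens X) : lmodType (sec X U) := (sec X U)^o.

Definition struct_res (U V : opens X) (VU : V `<=` U) :
    {additive struct_sec U -> struct_sec V} :=
  (res VU : {additive sec X U -> sec X V}).

Lemma struct_resZ (U V : opens X) (VU : V `<=` U) (a : sec X U)
  (m : struct_sec U) : struct_res VU (a *: m) = res VU a *: struct_res VU m.
Proof. exact: rmorphM. Qed.

Definition struct_mod : modsheaf X :=
  ModSheaf struct_resZ (res_sheaf X).
End StructureSheaf.
Arguments struct_mod {k} X.

(* Every point has an affine neighbourhood U such that E|U is the sheaf
   associated with a finitely generated O_X(U)-module, which is then E(U): the
   map E(U)_f -> E(basic_open f) is bijective for every f. *)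
Definition coherent (k : fieldType) (X : ringed_space k) (E : modsheaf X) :
    Prop :=
  forall x : X, exists U : opens X,
  [/\ U x, affine U,
      exists (n : nat) (b : 'I_n -> msec E U),
        forall m, exists c : 'I_n -> sec X U, m = \sum_(i < n) c i *: b i
    & forall f : sec X U,
        (forall m : msec E U, mres (@basic_open_sub _ _ _ f) m = 0 ->
           exists n, f ^+ n *: m = 0) /\
        (forall b : msec E (basic_open f), exists n (m : msec E U),
           res (@basic_open_sub _ _ _ f) (f ^+ n) *: b
           = mres (@basic_open_sub _ _ _ f) m)].

(* On an integral scheme: the germs of e_1, ..., e_r form a basis of the stalk
   of E at the generic point over the function field.  The neighbourhoods of
   the generic point are the nonempty open sets. *)
Definition has_rank (k : fieldType) (X : ringed_space k) (E : modsheaf X)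
    (r : nat) : Prop :=
  exists (U : opens X) (e : 'I_r -> msec E U),
  [/\ U !=set0,
      forall (V : opens X) (m : msec E V), V !=set0 ->
        exists (W : opens X) (WU : W `<=` U) (WV : W `<=` V)
          (a : 'I_r -> sec X W),
          W !=set0 /\ mres WV m = \sum_(i < r) a i *: mres WU (e i)
    & forall (V : opens X) (VU : V `<=` U) (a : 'I_r -> sec X V), V !=set0 ->
        \sum_(i < r) a i *: mres VU (e i) = 0 ->
        exists (W : opens X) (WV : W `<=` V),
          W !=set0 /\ forall i, res WV (a i) = 0].

Definition relatively_ulrich (k : fieldType) (X Y : ringed_space k)
    (pi : rs_hom X Y) (E : modsheaf X) : Prop :=
  coherent E /\
  exists r : nat, (0 < r)%N /\ mod_iso (pushforward pi E) (free_mod Y r).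

(* 1 |-> e is an isomorphism O_X|V -> L|V. *)
Definition is_frame (k : fieldType) (X : ringed_space k) (L : modsheaf X)
    (V : opens X) (e : msec L V) : Prop :=
  forall (W : opens X) (WV : W `<=` V) (m : msec L W),
    exists! a : sec X W, m = a *: mres WV e.

Definition line_bundle (k : fieldType) (X : ringed_space k) (L : modsheaf X) :
    Prop :=
  forall x : X, exists (V : opens X) (e : msec L V), V x /\ is_frame e.

Definition upd (d : nat) (T : Type) (v : 'I_d -> T) (i : 'I_d) (x : T) :
    'I_d -> T := fun j => if j == i then x else v j.

Record multilinear (k : fieldType) (X : ringed_space k) (d : nat)
    (L N : modsheaf X) := Multilinear {
  mlfun :> forall U : opens X, ('I_d -> msec L U) -> msec N U;
  mlfun_lin : forall (U : opens X) (v : 'I_d -> msec L U) (i : 'I_d)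
    (a : sec X U) (x y : msec L U),
    mlfun (upd v i (a *: x + y))
    = a *: mlfun (upd v i x) + mlfun (upd v i y);
  mlfun_nat : forall (U V : opens X) (VU : V `<=` U) (v : 'I_d -> msec L U),
    mlfun (fun i => mres VU (v i)) = mres VU (mlfun v)
}.
Arguments mlfun {k X d L N} _ {U} _.

(* The tensor power of L, as a sheaf of O_X-modules, through its universal
   property; [tens] is (a_1, ..., a_d) |-> a_1 (x) ... (x) a_d. *)
Record tensor_power (k : fieldType) (X : ringed_space k) (d : nat)
    (L : modsheaf X) := TensorPower {
  tmod :> modsheaf X;
  tens : multilinear d L tmod;
  tens_univ : forall (N : modsheaf X) (nu : multilinear d L N),
    exists h : mhom tmod N,
      (forall (U : opens X) (v : 'I_d -> msec L U),
         h U (mlfun tens v) = mlfun nu v) /\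
      forall h' : mhom tmod N,
        (forall (U : opens X) (v : 'I_d -> msec L U),
           h' U (mlfun tens v) = mlfun nu v) ->
        forall U m, h' U m = h U m
}.

(* M is the sheaf of O_X-linear maps from L to O_X, with evaluation pairing b;
   for a line bundle L this is its inverse. *)
Definition is_dual (k : fieldType) (X : ringed_space k) (L M : modsheaf X) :
    Prop :=
  exists b : forall U : opens X, msec M U -> msec L U -> sec X U,
  [/\ forall U a m m' l, b U (a *: m + m') l = a * b U m l + b U m' l,
      forall U a m l l', b U m (a *: l + l') = a * b U m l + b U m l',
      forall (U V : opens X) (VU : V `<=` U) m l,
        b V (mres VU m) (mres VU l) = res VU (b U m l)
    & forall (U : opens X)
        (phi : forall V : opens X, V `<=` U -> msec L V -> sec X V),
        (forall (V : opens X) (VU : V `<=` U) a l l',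
           phi V VU (a *: l + l') = a * phi V VU l + phi V VU l') ->
        (forall (V W : opens X) (VU : V `<=` U) (WV : W `<=` V)
           (WU : W `<=` U) l,
           phi W WU (mres WV l) = res WV (phi V VU l)) ->
        exists! m : msec M U, forall (V : opens X) (VU : V `<=` U) l,
          phi V VU l = b V (mres VU m) l].

(* p : T -> Y is the total space Spec Sym L^{-1} of the line bundle L.  The
   tautological section t of the pullback of L to T is given by its coordinates
   [coord e] in the frames e of L, so that t = coord e * e; they transform
   accordingly, and over affine open sets V with a frame e of L they make
   O_T(p^{-1} V) the polynomial ring O_Y(V)[coord e]. *)
Record total_space (k : fieldType) (Y T : ringed_space k) (L : modsheaf Y)
    (p : rs_hom T Y) := TotalSpace {
  coord : forall (V : opens Y) (e : msec L V), is_frame e ->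
    sec T (preim p V);
  coordE : forall (V V' W : opens Y) (e : msec L V) (e' : msec L V')
    (he : is_frame e) (he' : is_frame e') (WV : W `<=` V) (WV' : W `<=` V')
    (g : sec Y W), mres WV' e' = g *: mres WV e ->
    res (preimS (f := p) WV) (coord he)
    = comor p W g * res (preimS (f := p) WV') (coord he');
  total_affine : affine_morphism p;
  total_gen : forall (V : opens Y) (e : msec L V) (he : is_frame e),
    affine V -> forall f : sec T (preim p V),
    exists (n : nat) (c : 'I_n -> sec Y V),
      f = \sum_(i < n) comor p V (c i) * coord he ^+ i;
  total_free : forall (V : opens Y) (e : msec L V) (he : is_frame e),
    affine V -> forall (n : nat) (c : 'I_n -> sec Y V),
    \sum_(i < n) comor p V (c i) * coord he ^+ i = 0 -> forall i, c i = 0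
}.

(* pi exhibits Y as the quotient of X by a faithful action of Z/dZ; g n is the
   action of the class of n. *)
Definition cyclic_quotient (k : fieldType) (X Y : ringed_space k) (d : nat)
    (pi : rs_hom X Y) : Prop :=
  exists g : nat -> rs_hom X X,
    [/\ forall m n, is_comp (g n) (g m) (g (m + n)%N),
        forall n, is_id (g n) <-> (d %| n)%N
      & [/\ forall y : Y, exists x, pi x = y,
        forall x x' : X, pi x = pi x' <-> exists n, x' = g n x,
        forall V : set Y, open (pi @^-1` V) -> open V,
        forall V : opens Y, injective (comor pi V)
      & forall (V : opens Y) (f : sec X (preim pi V)),
          (exists a, comor pi V a = f) <->
          forall n (U : opens X) (UV : U `<=` preim pi V)
            (UgV : U `<=` preim (g n) (preim pi V)),
            res UgV (comor (g n) _ f) = res UV f]].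

(* pi_* O_X is the (internal) direct sum of copies of L^{-i}, 0 <= i < d. *)
Definition split_pushforward (k : fieldType) (X Y : ringed_space k) (d : nat)
    (L : modsheaf Y) (pi : rs_hom X Y) : Prop :=
  exists (M : modsheaf Y) (Mi : forall i : 'I_d, tensor_power i M)
    (j : forall i : 'I_d, mhom (Mi i) (pushforward pi (struct_mod X))),
    is_dual L M /\
    forall (V : opens Y) (f : msec (pushforward pi (struct_mod X)) V),
      exists! m : (forall i : 'I_d, msec (Mi i) V),
        f = \sum_(i < d) j i V (m i).

(* X is the closed subscheme {t^d = s} of the total space of L, over Y: in a
   frame e of L with s = sigma * e^d, its ideal is generated by
   (coord e)^d - sigma. *)
Definition cyclic_equation (k : fieldType) (X Y : ringed_space k) (d : nat)
    (L : modsheaf Y) (Ld : tensor_power d L) (s : msec Ld (otop Y))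
    (pi : rs_hom X Y) : Prop :=
  exists (T : ringed_space k) (p : rs_hom T Y) (tot : total_space L p)
    (i : rs_hom X T),
  [/\ is_scheme T, closed_immersion i, is_comp i p pi
    & forall (V : opens Y) (e : msec L V) (he : is_frame e) (sigma : sec Y V),
        affine V ->
        mres (@subsetT _ V : V `<=` otop Y) s
        = sigma *: mlfun (tens Ld) (fun=> e) ->
        forall f : sec T (preim p V),
          comor i (preim p V) f = 0 <->
          exists h, f = h * (coord tot he ^+ d - comor p V sigma)].

Definition standard_cyclic_cover (k : fieldType) (X Y : ringed_space k)
    (d : nat) (L : modsheaf Y) (Ld : tensor_power d L)
    (s : msec Ld (otop Y)) (pi : rs_hom X Y) : Prop :=
  [/\ finite_morphism pi, cyclic_quotient d pi, split_pushforward d L pi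
    & cyclic_equation s pi].

(* Main.v *)
(* Index the a_j by 0 <= j < d.  Let e_0 be a frame of L over a nonempty affine
   open V_0, write a_j = alpha_j e_0, and let t be the coordinate on
   X_0 = pi^{-1} V_0, so that t^d is the product of the alpha_j.  Put
   f_i = t^i prod_(j > i) alpha_j.  Then t f_i = alpha_{i+1} f_{i+1}, indices
   mod d, and this relation is invariant under change of frame: over an affine
   V with frame e, a_j = beta_j e and coordinate t_V, it reads
   t_V f_i = beta_{i+1} f_{i+1} on pi^{-1} (V /\ V_0).  Let E be the
   O_X-submodule of j_* O_{X_0} generated by the f_i, where j : X_0 -> X is the
   inclusion.  By the relation the f_i already span pi_* E over O_Y, and they
   are linearly independent because 1, t, ..., t^{d-1} are; hence pi_* E is
   free of rank d. *)

Require Import Defs.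
From HB Require Import structures.
From mathcomp Require Import all_boot all_order all_algebra ring zify.
From mathcomp Require Import boolp classical_sets functions topology.

Set Implicit Arguments.
Unset Strict Implicit.
Unset Printing Implicit Defensive.
Import GRing.Theory.
Local Open Scope classical_set_scope.
Local Open Scope ring_scope.
Local Notation preim := Defs.preim.

(** * Intersections of open sets; restriction, gluing and units of sections *)

Definition oI (X : topologicalType) (U V : opens X) : opens X :=
  Opens (openI (oset_open U) (oset_open V)).

Lemma oIl (X : topologicalType) (U V : opens X) : oI U V `<=` U.
Proof. by move=> x []. Qed.

Lemma oIr (X : topologicalType) (U V : opens X) : oI U V `<=` V.
Proof. by move=> x []. Qed.

Lemma oIS (X : topologicalType) (U V U' V' : opens X) :
  U `<=` U' -> V `<=` V' -> oI U V `<=` oI U' V'.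
Proof. by move=> UU' VV' x [/UU' ? /VV']. Qed.

Lemma sub_oI (X : topologicalType) (U V W : opens X) :
  W `<=` U -> W `<=` V -> W `<=` oI U V.
Proof. by move=> WU WV x Wx; split; [exact: WU|exact: WV]. Qed.

Hint Resolve subset_refl oIl oIr sub_oI oIS : core.

Section Restriction.
Context (k : fieldType) (X : ringed_space k).
Implicit Types U V W : opens X.

(* Restriction as a total operation, with junk value 0 when V is not contained
   in U: unlike [res], it carries no proof. *)
Definition rst U V (f : sec X U) : sec X V :=
  if pselect (V `<=` U) is left VU then res VU f else 0.
Arguments rst [U] V f.

Lemma rstE U V (VU : V `<=` U) (f : sec X U) : rst V f = res VU f.
Proof.
rewrite /rst; case: pselect => // VU'.
by rewrite (Prop_irrelevance VU VU').
Qed.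

Lemma rst_is_zmod U V : zmod_morphism (@rst U V).
Proof.
by move=> f g; rewrite /rst; case: pselect => [VU|_]; rewrite ?rmorphB ?subr0.
Qed.

HB.instance Definition _ U V :=
  GRing.isZmodMorphism.Build (sec X U) (sec X V) (@rst U V) (@rst_is_zmod U V).

Lemma rstM U V : {morph @rst U V : f g / f * g}.
Proof.
by move=> f g; rewrite /rst; case: pselect => [VU|_]; rewrite ?rmorphM ?mulr0.
Qed.

Lemma rst1 U V : V `<=` U -> rst V (1 : sec X U) = 1.
Proof. by move=> VU; rewrite rstE rmorph1. Qed.

Lemma rstXn U V (f : sec X U) n : V `<=` U -> rst V (f ^+ n) = rst V f ^+ n.
Proof. by move=> VU; rewrite !rstE rmorphXn. Qed.

Lemma rst_id U (f : sec X U) : rst U f = f.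
Proof. by rewrite (rstE (@subset_refl _ U)); have [->] := res_sheaf X. Qed.

Lemma rst_rst U V W (f : sec X U) : W `<=` V -> V `<=` U ->
  rst W (rst V f) = rst W f.
Proof.
move=> WV VU; have WU := subset_trans WV VU.
by rewrite (rstE WV) (rstE VU) (rstE WU); have [_ ->] := res_sheaf X.
Qed.

(** All pairs of an open set and a section with [P] form the glued family, so nothing has to be
    chosen; uniqueness supplies the compatibility on overlaps. *)
Lemma sec_glue U (P : forall V, sec X V -> Prop) :
  (forall V W (f : sec X V), V `<=` U -> W `<=` V -> P V f -> P W (rst W f)) ->
  (forall V (f g : sec X V), V `<=` U -> P V f -> P V g -> f = g) ->
  (forall x, U x -> exists V, [/\ V `<=` U, V x & exists f, P V f]) ->
  exists f : sec X U, forall V (g : sec X V), V `<=` U -> P V g -> rst V f = g.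
Proof.
move=> P_rst P_uniq P_cov.
pose I := {V : opens X & {f : sec X V | V `<=` U /\ P V f}}.
pose V (i : I) := projT1 i.
pose s (i : I) : sec X (V i) := sval (projT2 i).
have VU i : V i `<=` U by have [] := svalP (projT2 i).
have sP i : P (V i) (s i) by have [] := svalP (projT2 i).
have [_ _ glue] := res_sheaf X.
have [x|i j W Wi Wj|t [tP _]] := glue U I V VU _ s.
- move=> /P_cov[W [WU Wx [f Pf]]].
  by exists (existT _ W (exist _ f (conj WU Pf))).
- rewrite -!rstE; apply: P_uniq; [|exact: P_rst|exact: P_rst].
  exact: subset_trans (VU i).
exists t => W f WU Pf; pose i : I := existT _ W (exist _ f (conj WU Pf)).
by have := tP i; rewrite -rstE.
Qed.

Lemma sec_ext U (f g : sec X U) :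
  (forall x, U x -> exists V, [/\ V `<=` U, V x & rst V f = rst V g]) -> f = g.
Proof.
move=> fg; have [_ _ glue] := res_sheaf X.
pose I := {V : opens X | V `<=` U /\ rst V f = rst V g}.
pose V (i : I) := sval i.
have VU i : V i `<=` U by have [] := svalP i.
have [x|i j W Wi Wj|t [_ t_uniq]] := glue U I V VU _ (fun i => res (VU i) f).
- by move=> /fg[W [WU Wx fgW]]; exists (exist _ W (conj WU fgW)).
- rewrite -!rstE !rst_rst //.
rewrite -(t_uniq f) // -(t_uniq g) // => i.
by rewrite -!rstE; have [_ ->] := svalP i.
Qed.

Lemma sec_empty U (f g : sec X U) : ~ (U !=set0) -> f = g.
Proof. by move=> U0; apply: sec_ext => x Ux; case: U0; exists x. Qed.

Lemma unit_atP U (f : sec X U) x : unit_at f x <->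
  exists V, [/\ V `<=` U, V x & exists g, rst V f * g = 1].
Proof.
split=> [[V [VU [Vx [g fg]]]]|[V [VU Vx [g fg]]]].
  by exists V; split=> //; exists g; rewrite (rstE VU).
by exists V, VU; split=> //; exists g; rewrite -rstE.
Qed.

Lemma unit_at_dom U (f : sec X U) x : unit_at f x -> U x.
Proof. by move=> /unit_atP[V [VU /VU]]. Qed.

Lemma unit_at_rst U V (f : sec X U) x : V `<=` U ->
  unit_at (rst V f) x <-> V x /\ unit_at f x.
Proof.
move=> VU; split=> [fx|[Vx]].
  split; first exact: unit_at_dom fx.
  move: fx => /unit_atP[W [WV Wx [g]]]; rewrite rst_rst // => fg.
  apply/unit_atP; exists W; split=> //; last by exists g.
  exact: subset_trans VU.
move=> /unit_atP[W [WU Wx [g fg]]]; apply/unit_atP; exists (oI V W); split=> //.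
exists (rst _ g); rewrite rst_rst // -(rst_rst f (@oIr _ V W)) //.
by rewrite -rstM fg rst1.
Qed.

Lemma unit_atM U (f g : sec X U) x :
  unit_at (f * g) x <-> unit_at f x /\ unit_at g x.
Proof.
split=> [/unit_atP[V [VU Vx [h fgh]]]|[]].
  by split; apply/unit_atP; exists V; split=> //;
    [exists (rst V g * h)|exists (rst V f * h)]; rewrite -fgh rstM; ring.
move=> /unit_atP[V [VU Vx [f' ff']]] /unit_atP[W [WU Wx [g' gg']]].
apply/unit_atP; exists (oI V W); split=> //.
  by apply: subset_trans VU; exact: oIl.
exists (rst _ f' * rst _ g').
have := congr1 (rst (oI V W)) ff'; have := congr1 (rst (oI V W)) gg'.
rewrite !rstM !rst_rst // !rst1 // => gg'1 ff'1.
by rewrite mulrACA ff'1 gg'1 mulr1.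
Qed.

Lemma unit_at1 U x : U x -> unit_at (1 : sec X U) x.
Proof.
move=> Ux; apply/unit_atP; exists U; split=> //.
by exists 1; rewrite rst1 // mulr1.
Qed.

Lemma unit_atXn U (f : sec X U) n x : unit_at f x -> unit_at (f ^+ n) x.
Proof.
move=> fx; elim: n => [|n IHn]; first exact/unit_at1/(unit_at_dom fx).
by rewrite exprS; apply/unit_atM.
Qed.

(** Local inverses are unique, so they glue. *)
Lemma unit_sec U (f : sec X U) : (forall x, U x -> unit_at f x) ->
  exists g, f * g = 1.
Proof.
move=> fU; have [||x|g gP] := @sec_glue U (fun V g => rst V f * g = 1).
- move=> V W g VU WV fg.
  by rewrite -(rst_rst f WV VU) -rstM fg rst1.
- by move=> V g h VU fg fh; rewrite -[g]mulr1 -fh mulrA [g * _]mulrC fg mul1r.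
- by move=> /fU/unit_atP.
exists g; apply: sec_ext => x /fU/unit_atP[V [VU Vx [h fh]]].
by exists V; split=> //; rewrite rstM (gP V h) // fh rst1.
Qed.

End Restriction.
Arguments rst {k X U} V f.

(** * Prime ideals, affine opens and integral schemes *)

Definition ideal (R : comPzRingType) (I : set R) : Prop :=
  [/\ I 0, forall a b, I a -> I b -> I (a + b) & forall a b, I b -> I (a * b)].

(** Zorn's lemma: an ideal maximal among those that contain [I] and avoid all powers of [h] is
    prime. *)
Lemma exists_prime (R : comPzRingType) (I : set R) (h : R) :
  ideal I -> (forall n, ~ I (h ^+ n)) ->
  exists P, [/\ prime_ideal P, I `<=` P & ~ P h].
Proof.
move=> I_ideal Ih; have [I0 ID IM] := I_ideal.
pose T := {J : set R | [/\ ideal J, I `<=` J & forall n, ~ J (h ^+ n)]}.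
pose le (J K : T) := `[< sval J `<=` sval K >].
have [||||[P P_T] P_max] := @Zorn T le.
- by move=> J; apply/asboolP.
- move=> J K L /asboolP JK /asboolP KL; apply/asboolP; exact: subset_trans KL.
- move=> [J pJ] [K pK] /asboolP/= JK /asboolP/= KJ.
  have eJK : J = K by exact/seteqP.
  by move: pJ; rewrite eJK => pJ; rewrite (Prop_irrelevance pJ pK).
(* Joining [I] to the union gives an upper bound even for the empty chain. *)
- move=> A A_tot; pose U := I `|` [set x | exists2 J, A J & sval J x].
  have U_ideal : ideal U.
    have IJ (J : T) : I `<=` sval J by case: (svalP J).
    have JD (J : T) a b : sval J a -> sval J b -> sval J (a + b).
      by have [[_ + _] _ _] := svalP J; apply.
    split=> [|a b [Ia|[J AJ Ja]] [Ib|[K AK Kb]]|a b [Ib|[J AJ Jb]]].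
    + by left.
    + by left; exact: ID.
    + by right; exists K => //; apply: JD => //; exact: IJ.
    + by right; exists J => //; apply: JD => //; exact: IJ.
    + have [/asboolP JK|/asboolP KJ] := A_tot _ _ AJ AK.
        by right; exists K => //; apply: JD => //; exact: JK.
      by right; exists J => //; apply: JD => //; exact: KJ.
    + by left; exact: IM.
    + by right; exists J => //; have [[_ _ +] _ _] := svalP J; apply.
  have Uh n : ~ U (h ^+ n).
    move=> [|[J AJ]]; first exact: Ih.
    by have [_ _ +] := svalP J; apply.
  exists (exist _ U (And3 U_ideal (@subsetUl _ _ _) Uh)) => J AJ.
  by apply/asboolP => x Jx; right; exists J.
have [[P0 PD PM] IP Ph] := P_T.
(* Otherwise [P + (a)] would be a larger ideal avoiding all powers of [h]. *)
have P_bigger a : ~ P a -> exists n p r, P p /\ h ^+ n = p + r * a.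
  move=> Pa; apply: contrapT => hn.
  pose K := [set x | exists p r, P p /\ x = p + r * a].
  have PK : P `<=` K by move=> p Pp; exists p, 0; split=> //; ring.
  have K_ideal : ideal K.
    split; first exact: PK.
      move=> _ _ [p [r [Pp ->]]] [q [s [Pq ->]]].
      by exists (p + q), (r + s); split; [exact: PD|ring].
    move=> b _ [p [r [Pp ->]]]; exists (b * p), (b * r).
    by split; [exact: PM|ring].
  have Kh n : ~ K (h ^+ n) by move=> [p [r pr]]; apply: hn; exists n, p, r.
  have /(_ (asboolT PK))/(congr1 sval)/= KP :=
    P_max (exist _ K (And3 K_ideal (subset_trans IP PK) Kh)).
  apply: Pa; rewrite -KP.
  by exists 0, 1; split=> //; ring.
exists P; split=> //; last by move=> Ph1; apply: (Ph 1%N); rewrite expr1.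
split=> // [P1|a b Pab]; first by apply: (Ph 0%N).
apply: contrapT => /not_orP[/P_bigger[m [p [r [Pp hm]]]]].
move=> /P_bigger[n [q [s [Pq hn]]]]; apply: (Ph (m + n)%N).
rewrite exprD hm hn.
have -> : (p + r * a) * (q + s * b)
    = (q + s * b) * p + (r * a * q + r * s * (a * b)) by ring.
by apply: (PD); [|apply: PD]; exact: PM.
Qed.

Lemma opens_eq (X : topologicalType) (U V : opens X) :
  (forall x, U x <-> V x) -> U = V.
Proof.
case: U V => [U oU] [V oV] /= UV.
have eqUV : U = V by apply/seteqP; split=> x /UV.
by move: oU; rewrite eqUV => oU; congr Opens; exact: Prop_irrelevance.
Qed.

Section Affine.
Context (k : fieldType) (X : ringed_space k).
Implicit Types U V W D : opens X.

(** If no power of [h] is in [I], some prime contains [I] and misses [h]; the point of [U] with this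
    prime contradicts the covering hypothesis. *)
Lemma affine_radical U (I : set (sec X U)) (h : sec X U) :
  affine U -> ideal I ->
  (forall x, unit_at h x -> exists2 g, I g & unit_at g x) ->
  exists n, I (h ^+ n).
Proof.
move=> [U_pts _ _] I_ideal Ih; apply: contrapT => hn.
have [n In|P [P_prime IP Ph]] := exists_prime (h := h) I_ideal.
  by apply: hn; exists n.
have [x [[Ux Px] _]] := U_pts P P_prime.
have [|g /IP/Px] := Ih x; last by [].
by apply: contrapT => /Px.
Qed.

Lemma affine_basis U W x : affine U -> W `<=` U -> W x ->
  exists f : sec X U, basic_open f x /\ basic_open f `<=` W.
Proof. by move=> [_ U_basis _]; exact: U_basis. Qed.

(** [D] is tied to [f] by an equation because the same open set is later presented as the basic open
    set of another function. *)
Lemma affine_loc0 U D (f a : sec X U) : affine U -> D = basic_open f ->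
  rst D a = 0 -> exists n, f ^+ n * a = 0.
Proof.
move=> [_ _ U_loc] ->; rewrite (rstE (@basic_open_sub _ _ _ f)).
by have [+ _] := U_loc f; apply.
Qed.

Lemma affine_loc U D (f : sec X U) (b : sec X D) : affine U ->
  D = basic_open f -> exists n (a : sec X U), rst D (f ^+ n) * b = rst D a.
Proof.
move=> [_ _ U_loc] eD; move: b; rewrite eD => b.
have [_ /(_ b)[n [a ba]]] := U_loc f.
by exists n, a; rewrite !(rstE (@basic_open_sub _ _ _ f)).
Qed.

(** The basic open set is the spectrum of the localization at [f]: a function on it, multiplied by a
    power of the unit [f], is restricted from [U]. This carries the three conditions over from
    [U]. *)
Lemma affine_basic_open U (f : sec X U) : affine U -> affine (basic_open f).
Proof.
move=> U_aff; pose D := basic_open f.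
have DU : D `<=` U by exact: basic_open_sub.
have [g fg] : exists g, rst D f * g = 1.
  by apply: unit_sec => x fx; apply/unit_at_rst.
have fgn n : rst D f ^+ n * g ^+ n = 1 by rewrite -exprMn fg expr1n.
have unit_rst (a : sec X U) x : D x -> unit_at (rst D a) x <-> unit_at a x.
  by move=> Dx; split=> [/unit_at_rst[]|ax] //; apply/unit_at_rst.
have unit_frac n (a : sec X U) (b : sec X D) x :
    D x -> rst D (f ^+ n) * b = rst D a -> unit_at b x <-> unit_at a x.
  move=> Dx ba; rewrite -(unit_rst a) // -ba unit_atM unit_rst //.
  by split=> [bx|[]] //; split=> //; exact: unit_atXn.
split.
- move=> P [P0 PD PM P1 PX].
  have P_frac n (a : sec X U) (b : sec X D) :
      rst D (f ^+ n) * b = rst D a -> P b <-> P (rst D a).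
    move=> <-; split=> [|Pfb]; first exact: PM.
    suff -> : b = g ^+ n * (rst D (f ^+ n) * b) by exact: PM.
    by rewrite mulrA [g ^+ n * _]mulrC rstXn // fgn mul1r.
  have [U_pts _ _] := U_aff.
  (* The prime is contracted to [sec X U]. Its point lies in [D], since [f] becomes a unit on [D]
     and so is not in the contraction. *)
  have [|x [[Ux Px] x_uniq]] := U_pts [set a | P (rst D a)].
    split=> /=; rewrite ?raddf0 ?rst1 // => a b; rewrite ?raddfD ?rstM.
    + exact: PD.
    + exact: PM.
    + exact: PX.
  have Dx : D x.
    by apply: contrapT => /Px/(PM g); rewrite mulrC fg.
  exists x; split=> [|y [Dy Py]].
    split=> // b; have [n [a ba]] := affine_loc b U_aff erefl.
    by rewrite (P_frac _ _ _ ba) (unit_frac _ _ _ _ Dx ba); exact: Px.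
  apply: x_uniq; split=> [|a]; first exact: DU.
  by rewrite -unit_rst //; exact: Py.
- move=> W x WD Wx.
  have [h [hx hW]] := affine_basis U_aff (subset_trans WD DU) Wx.
  exists (rst D h); split.
    by apply/unit_at_rst => //; split=> //; exact: WD.
  by move=> y /unit_at_rst-/(_ DU)[_]; exact: hW.
(* Writing [b] as [a / f^n], the basic open set of [b] inside [D] is that of [f * a] inside [U], so
   the localization property of [U] applies to it. *)
move=> b; have [n [a ba]] := affine_loc b U_aff erefl.
pose E := basic_open b.
have ED : E `<=` D by exact: basic_open_sub.
have EU : E `<=` U by exact: subset_trans DU.
have eE : E = basic_open (f * a).
  apply: opens_eq => x; rewrite /= unit_atM; split=> [bx|[fx ax]].
    have Dx := ED _ bx; split=> //.
    by apply/(unit_frac _ _ _ _ Dx ba).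
  by apply/(unit_frac _ _ _ _ _ ba).
have faE m : rst D ((f * a) ^+ m) = rst D f ^+ (n.+1 * m) * b ^+ m.
  by rewrite rstXn // rstM -ba rstXn // mulrA -exprS exprMn exprM.
split=> c.
  rewrite -rstE => c0; have [m [a' ca']] := affine_loc c U_aff erefl.
  have [|p fap] := affine_loc0 (a := a') U_aff eE.
    by rewrite -(rst_rst a' ED DU) -ca' rstM c0 mulr0.
  exists p.
  have := congr1 (rst D) fap; rewrite raddf0 rstM faE -ca' rstXn // => fbfc.
  have -> : b ^+ p * c =
      g ^+ (n.+1 * p) * g ^+ m
      * (rst D f ^+ (n.+1 * p) * b ^+ p * (rst D f ^+ m * c)).
    rewrite -[LHS]mul1r -(fgn (n.+1 * p)%N) -[LHS]mul1r -(fgn m); ring.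
  by rewrite fbfc mulr0.
have [m [a' ca']] := affine_loc c U_aff eE.
exists m, (g ^+ (n.+1 * m) * rst D a').
rewrite -!rstE rstM rst_rst // -ca' -(rst_rst _ ED DU) faE rstM !mulrA -rstM.
by rewrite [g ^+ _ * _]mulrC fgn rst1 // mul1r.
Qed.

Lemma affine_nbhd U x : is_scheme X -> U x ->
  exists V, [/\ affine V, V x & V `<=` U].
Proof.
move=> [_ X_aff] Ux; have [V [Vx V_aff]] := X_aff x.
have [f [fx fUV]] := affine_basis V_aff (@oIr _ U V) (conj Ux Vx).
exists (basic_open f); split=> //; first exact: affine_basic_open.
exact: subset_trans (@oIl _ U V).
Qed.
End Affine.

(** * Integral schemes: irreducibility and injectivity of restriction *)

Section Integral.
Context (k : fieldType) (X : ringed_space k).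
Hypotheses (X_sch : is_scheme X) (X_int : integral X).
Implicit Types U V W D : opens X.

Lemma sec1_neq0 U : U !=set0 -> (1 : sec X U) != 0.
Proof. by move=> U0; have [_ /(_ U U0)[]] := X_int. Qed.

Lemma sec_mulf_eq0 U (f g : sec X U) : f * g = 0 -> f = 0 \/ g = 0.
Proof.
have [U0|U0] := pselect (U !=set0).
  by have [_ /(_ U U0)[_]] := X_int; apply.
by left; exact: sec_empty.
Qed.

Lemma sec_mulIf U (f g : sec X U) : f != 0 -> f * g = 0 -> g = 0.
Proof. by move=> /eqP f0 /sec_mulf_eq0[]. Qed.

Lemma sec_expf_eq0 U (f : sec X U) n : f ^+ n = 0 -> f = 0.
Proof.
have [U0|U0] := pselect (U !=set0); last by move=> _; exact: sec_empty.
elim: n => [/eqP|n IHn]; first by rewrite (negPf (sec1_neq0 U0)).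
by rewrite exprS => /sec_mulf_eq0[|/IHn].
Qed.

Lemma not_unit_at0 U x : ~ unit_at (0 : sec X U) x.
Proof.
move=> /unit_atP[V [VU Vx [g]]]; rewrite raddf0 mul0r => /esym/eqP.
by rewrite (negPf (sec1_neq0 _)) //; exists x.
Qed.

(** Otherwise the section equal to 1 on [U] and to 0 on [V] would be a nontrivial idempotent on the
    union. *)
Lemma opens_meet U V : U !=set0 -> V !=set0 -> oI U V !=set0.
Proof.
move=> U0 V0; apply: contrapT => UV0.
pose W := Opens (openU (oset_open U) (oset_open V)).
have UW : U `<=` W by exact: subsetUl.
have VW : V `<=` W by exact: subsetUr.
have disj Z : Z `<=` U -> Z `<=` V -> ~ (Z !=set0).
  by move=> ZU ZV [x Zx]; apply: UV0; exists x; split; [exact: ZU|exact: ZV].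
have [||x|e eP] := @sec_glue _ X W
  (fun Z f => Z `<=` U /\ f = 1 \/ Z `<=` V /\ f = 0).
- move=> Z Z' f _ Z'Z [[ZU ->]|[ZV ->]]; [left|right]; split.
  + exact: subset_trans ZU.
  + exact: rst1.
  + exact: subset_trans ZV.
  + exact: raddf0.
- move=> Z f g _ [[ZU ->]|[ZV ->]] [[ZU' ->]|[ZV' ->]] //; apply: sec_empty;
  exact: disj.
- by move=> [Ux|Vx]; [exists U|exists V]; split=> //;
    [exists 1; left|exists 0; right].
have eU : rst U e = 1 by apply: eP => //; left.
have eV : rst V e = 0 by apply: eP => //; right.
have /sec_mulf_eq0[e0|e1] : e * (1 - e) = 0.
  apply: sec_ext => x [Ux|Vx]; [exists U|exists V]; split=> //;
  by rewrite rstM raddfB /= rst1 // ?eU ?eV raddf0; ring.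
- by have := sec1_neq0 U0; rewrite -eU e0 raddf0 eqxx.
- by have := sec1_neq0 V0; rewrite -(rst1 VW) -[1](subrK e) e1 add0r eV eqxx.
Qed.

(** An affine [W] around any point meets [V], so some nonempty [basic_open g] lies in both. There
    [f] vanishes, hence [g ^+ n * f = 0] on [W], and [g ^+ n] is nonzero. *)
Lemma rst_eq0 U V (f : sec X U) : V `<=` U -> V !=set0 ->
  rst V f = 0 -> f = 0.
Proof.
move=> VU V0 fV; apply: sec_ext => x Ux.
have [W [W_aff Wx WU]] := affine_nbhd X_sch Ux.
exists W; split=> //; rewrite raddf0.
have [|y [Wy Vy]] := @opens_meet W V _ V0; first by exists x.
have [g [gy gWV]] := affine_basis W_aff (@oIl _ W V) (conj Wy Vy).
have [|n gnf] := affine_loc0 (f := g) (a := rst W f) W_aff erefl.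
  have gV : basic_open g `<=` V by exact: subset_trans (@oIr _ W V).
  rewrite rst_rst //; last exact: basic_open_sub.
  by rewrite -(rst_rst f gV VU) fV raddf0.
apply: sec_mulIf gnf; apply/eqP => gn.
by apply: (@not_unit_at0 W y); rewrite -gn; exact: unit_atXn.
Qed.

Lemma rst_inj U V (f g : sec X U) : V `<=` U -> V !=set0 ->
  rst V f = rst V g -> f = g.
Proof.
move=> VU V0 fg; apply/eqP; rewrite -subr_eq0; apply/eqP.
by apply: (rst_eq0 VU V0); rewrite raddfB /= fg subrr.
Qed.

(** If the basic open set were empty, 1 would vanish on it, so on small affine open sets a power of
    [f], hence [f] itself, would be 0. *)
Lemma basic_open_neq0 U (f : sec X U) : f != 0 -> basic_open f !=set0.
Proof.
move=> f0; apply: contrapT => Df0; move/eqP: f0; apply.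
apply: sec_ext => x Ux; have [W [W_aff Wx WU]] := affine_nbhd X_sch Ux.
exists W; split=> //; rewrite raddf0.
have [|n] := affine_loc0 (f := rst W f) (a := 1) W_aff erefl.
  apply: sec_empty => -[y /= /unit_at_rst-/(_ WU)[_ fy]].
  by apply: Df0; exists y.
by rewrite mulr1; exact: sec_expf_eq0.
Qed.

End Integral.

(** * The sheaf generated by sections over an open set *)

Section Submodule.
Context (R : pzRingType) (V : lmodType R).

Definition submod_pred (S : {pred V}) of GRing.submod_closed S : {pred V} := S.

HB.instance Definition _ (S : {pred V}) (S_sub : GRing.submod_closed S) :=
  GRing.isSubmodClosed.Build R V (submod_pred S_sub) S_sub.

Definition submod (S : {pred V}) (S_sub : GRing.submod_closed S) : Type :=
  {x : V | x \in submod_pred S_sub}.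

HB.instance Definition _ (S : {pred V}) (S_sub : GRing.submod_closed S) :=
  SubChoice.on (submod S_sub).
HB.instance Definition _ (S : {pred V}) (S_sub : GRing.submod_closed S) :=
  [SubChoice_isSubLmodule of submod S_sub by <:].
End Submodule.

(* The subsheaf of O_X-modules of j_* O_{X0}, j : X0 -> X, generated by
   sections f_1, ..., f_d of O_X on X0. *)
Section GeneratedSheaf.
Context (k : fieldType) (X : ringed_space k) (X0 : opens X).
Context (d : nat) (f : 'I_d -> sec X X0).
Implicit Types U V W Z : opens X.

(** Meant for [Z] inside both [U] and [X0], where no restriction takes its default value 0. *)
Definition comb U (Z : opens X) (c : 'I_d -> sec X U) : sec X Z :=
  \sum_(i < d) rst Z (c i) * rst Z (f i).
Arguments comb [U] Z c.

(** A section of [j_* O_{X0}] over [U] lives on [oI U X0], but its local coefficients have to be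
    regular on all of [W], not just on [oI W X0]. *)
Definition loc_gen U (m : sec X (oI U X0)) : Prop :=
  forall x, U x -> exists W, [/\ W `<=` U, W x &
    exists c : 'I_d -> sec X W, rst (oI W X0) m = comb (oI W X0) c].

Lemma comb_rst U V Z (c : 'I_d -> sec X U) : Z `<=` V -> V `<=` U ->
  comb Z (fun i => rst V (c i)) = comb Z c.
Proof. by move=> ZV VU; apply: eq_bigr => i _; rewrite rst_rst. Qed.

Lemma rst_comb U Z Z' (c : 'I_d -> sec X U) : Z' `<=` Z -> Z `<=` oI U X0 ->
  rst Z' (comb Z c) = comb Z' c.
Proof.
move=> Z'Z ZUX0; rewrite raddf_sum; apply: eq_bigr => i _ /=.
by rewrite rstM !rst_rst //; apply: subset_trans ZUX0 _.
Qed.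

Lemma combD U Z (c c' : 'I_d -> sec X U) :
  comb Z (fun i => c i + c' i) = comb Z c + comb Z c'.
Proof.
by rewrite -big_split; apply: eq_bigr => i _; rewrite raddfD mulrDl.
Qed.

Lemma combZ U Z (a : sec X U) (c : 'I_d -> sec X U) :
  comb Z (fun i => a * c i) = rst Z a * comb Z c.
Proof. by rewrite mulr_sumr; apply: eq_bigr => i _; rewrite rstM mulrA. Qed.

Lemma comb0 U Z : comb Z (fun=> 0 : sec X U) = 0.
Proof. by apply: big1 => i _; rewrite raddf0 mul0r. Qed.

Lemma comb_delta U Z (i : 'I_d) : Z `<=` U ->
  comb Z (fun j => (j == i)%:R : sec X U) = rst Z (f i).
Proof.
move=> ZU; rewrite /comb (bigD1 i) //= eqxx rst1 // mul1r big1 ?addr0 //.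
by move=> j /negPf ->; rewrite raddf0 mul0r.
Qed.

Lemma loc_gen_rst U V (m : sec X (oI U X0)) : V `<=` U ->
  loc_gen m -> loc_gen (rst (oI V X0) m).
Proof.
move=> VU m_gen x Vx; have [W [WU Wx [c mc]]] := m_gen x (VU x Vx).
have WI : oI (oI V W) X0 `<=` oI W X0 by exact: oIS.
exists (oI V W); split=> //; exists (fun i => rst _ (c i)).
rewrite rst_rst; [|exact: oIS|exact: oIS].
by rewrite comb_rst // -(rst_comb c WI) // -mc rst_rst //; exact: oIS.
Qed.

Lemma loc_gen_comb U (c : 'I_d -> sec X U) : loc_gen (comb (oI U X0) c).
Proof. by move=> x Ux; exists U; split=> //; exists c; rewrite rst_id. Qed.

Definition gen_ambient U : lmodType (sec X U) :=
  restr_scal (res (@oIl _ U X0)) ((sec X (oI U X0))^o).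

Lemma gen_closed U :
  GRing.submod_closed (fun m : gen_ambient U => `[<@loc_gen U m>]).
Proof.
split=> [|a m m' /asboolP m_gen /asboolP m'_gen]; apply/asboolP => x Ux.
  exists U; split=> //; exists (fun=> 0).
  by rewrite comb0; exact: raddf0.
have [W [WU Wx [c mc]]] := m_gen x Ux.
have [W' [W'U W'x [c' mc']]] := m'_gen x Ux.
pose Z := oI W W'; have ZU : Z `<=` U by exact: subset_trans (@oIl _ W W') WU.
have ZW : Z `<=` W := @oIl _ W W'; have ZW' : Z `<=` W' := @oIr _ W W'.
have IZ : oI Z X0 `<=` Z by []; have IU := subset_trans IZ ZU.
exists Z; split=> //.
exists (fun i => rst Z a * rst Z (c i) + rst Z (c' i)).
rewrite combD combZ !comb_rst // rst_rst //.
have IW : oI Z X0 `<=` oI W X0 by exact: oIS.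
have IW' : oI Z X0 `<=` oI W' X0 by exact: oIS.
rewrite -(rst_comb c IW) // -(rst_comb c' IW') // -mc -mc'.
rewrite !rst_rst //; [|exact: oIS|exact: oIS].
transitivity (rst (oI Z X0) (res (@oIl _ U X0) a * (m : sec X (oI U X0)) + m')).
  by [].
by rewrite raddfD /= rstM -rstE rst_rst //; exact: oIS.
Qed.

Definition gen_sec U : lmodType (sec X U) := submod (gen_closed U).

Definition gval U (m : gen_sec U) : sec X (oI U X0) := val m.
Arguments gval [U] m.

Lemma gval_inj U : injective (@gval U).
Proof. exact: val_inj. Qed.

Lemma gvalP U (m : gen_sec U) : loc_gen (gval m).
Proof. by have /asboolP := valP m. Qed.

Lemma gvalD U (m m' : gen_sec U) : gval (m + m') = gval m + gval m'.
Proof. by []. Qed.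

Lemma gvalB U (m m' : gen_sec U) : gval (m - m') = gval m - gval m'.
Proof. by []. Qed.

Lemma gvalZ U (a : sec X U) (m : gen_sec U) :
  gval (a *: m) = rst (oI U X0) a * gval m.
Proof. by rewrite (rstE (@oIl _ U X0)). Qed.

Definition gmk U (b : sec X (oI U X0)) (bP : loc_gen b) : gen_sec U :=
  exist _ (b : gen_ambient U) (asboolT bP).

Lemma gmkK U (b : sec X (oI U X0)) (bP : loc_gen b) : gval (gmk bP) = b.
Proof. by []. Qed.

Section Restriction.
Context (U V : opens X) (VU : V `<=` U).

Definition gen_res_fun (m : gen_sec U) : gen_sec V :=
  gmk (loc_gen_rst VU (gvalP m)).

Lemma gen_res_is_zmod : zmod_morphism gen_res_fun.
Proof. by move=> m m'; apply: gval_inj; rewrite gvalB !gmkK gvalB raddfB. Qed.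

HB.instance Definition _ :=
  GRing.isZmodMorphism.Build (gen_sec U) (gen_sec V)
    gen_res_fun gen_res_is_zmod.

Definition gen_res : {additive gen_sec U -> gen_sec V} := gen_res_fun.

Lemma gval_res m : gval (gen_res m) = rst (oI V X0) (gval m).
Proof. by []. Qed.
End Restriction.

Lemma gen_resZ U V (VU : V `<=` U) (a : sec X U) (m : gen_sec U) :
  gen_res VU (a *: m) = res VU a *: gen_res VU m.
Proof.
apply: gval_inj; rewrite gval_res !gvalZ gval_res rstM -rstE !rst_rst //.
exact: oIS.
Qed.

(** Gluing takes place in [O_X] over the sets [oI (V i) X0]; being locally generated is a local
    condition and passes to the glued section. *)
Lemma gen_sheaf : is_sheaf (fun U V VU => gen_res (U := U) (V := V) VU).
Proof.
split.
- by move=> U UU s; apply: gval_inj; rewrite gval_res rst_id.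
- move=> U V W VU WV WU s; apply: gval_inj.
  by rewrite !gval_res rst_rst //; exact: oIS.
move=> U I V VU Ucov s s_compat.
have [_ _ glue] := res_sheaf X.
have VU' i : oI (V i) X0 `<=` oI U X0 by exact: oIS.
have [|i j W Wi Wj|t [tP t_uniq]] :=
    glue (oI U X0) I (fun i => oI (V i) X0) VU' _ (fun i => gval (s i)).
- by move=> x [/Ucov[i Vx] X0x]; exists i.
- have WI : W `<=` oI (oI (V i) (V j)) X0.
    by move=> x Wx; have [Vix X0x] := Wi x Wx; have [Vjx _] := Wj x Wx.
  have := s_compat i j (oI (V i) (V j)) (@oIl _ _ _) (@oIr _ _ _).
  move=> /(congr1 (@gval _))/(congr1 (rst W)); rewrite !gval_res.
  by rewrite !rst_rst -?rstE //; exact: oIS.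
have tgen : loc_gen t.
  move=> x /Ucov[i Vx]; have [W [WV Wx [c sc]]] := gvalP (s i) Vx.
  exists W; split=> //; first exact: subset_trans (VU i).
  exists c; rewrite -sc -tP -rstE rst_rst //; exact: oIS.
exists (gmk tgen); split=> [i|m mP].
  by apply: gval_inj; rewrite gval_res gmkK (rstE (VU' i)) tP.
apply: gval_inj; apply: t_uniq => i.
by rewrite -mP gval_res -rstE.
Qed.

Definition generated_sheaf : modsheaf X := ModSheaf gen_resZ gen_sheaf.

End GeneratedSheaf.

(** * Coherence and rank of the generated sheaf on an integral scheme *)

Section GeneratedSheafTheory.
Context (k : fieldType) (X : ringed_space k).
Hypotheses (X_sch : is_scheme X) (X_int : integral X).
Context (X0 : opens X) (X0_neq0 : X0 !=set0) (d : nat) (f : 'I_d -> sec X X0).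
Implicit Types U V W Z D : opens X.

Lemma denominators U D (g : sec X U) (c : 'I_d -> sec X D) : affine U ->
  D = basic_open g ->
  exists n (a : 'I_d -> sec X U), forall i, rst D (g ^+ n) * c i = rst D (a i).
Proof.
move=> U_aff eD.
have [n nP] := choice (fun i => affine_loc (c i) U_aff eD).
have [a aP] := choice nP.
(* The sum bounds every exponent, so one power of [g] serves as denominator for all coefficients. *)
pose N := (\sum_(i < d) n i)%N.
exists N, (fun i => g ^+ (N - n i) * a i) => i.
rewrite rstM -aP mulrA -rstM -exprD subnK //.
by rewrite /N (bigD1 i) //= leq_addr.
Qed.

(* The g for which g b is a combination of the f_i form an ideal, which contains
   a unit at every point of D(h); hence it contains a power of h. *)
Lemma loc_gen_affine U D (h : sec X U) (b : sec X (oI D X0)) : affine U ->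
  D = basic_open h -> loc_gen f b ->
  exists n (c : 'I_d -> sec X U),
    rst (oI D X0) (h ^+ n) * b = comb f (oI D X0) c.
Proof.
move=> U_aff eD b_gen; have DU : D `<=` U by rewrite eD; exact: basic_open_sub.
pose Z := oI D X0; have ZD : Z `<=` D by exact: oIl.
have ZU := subset_trans ZD DU.
have [|x hx|n [c nc]] := @affine_radical _ X U
  [set g | exists c : 'I_d -> sec X U, rst Z g * b = comb f Z c] h U_aff.
- split=> [|g g' [c gc] [c' gc']|g g' [c gc]].
  + by exists (fun=> 0); rewrite comb0 raddf0 mul0r.
  + by exists (fun i => c i + c' i); rewrite combD raddfD mulrDl gc gc'.
  + by exists (fun i => g * c i); rewrite combZ rstM -mulrA gc.
- have Dx : D x by rewrite eD.
  have [W [WD Wx [c bc]]] := b_gen x Dx.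
  have WU := subset_trans WD DU.
  have [g [gx gW]] := affine_basis U_aff WU Wx.
  pose E := basic_open g; have ED : E `<=` D by exact: subset_trans WD.
  have EU : E `<=` U by exact: subset_trans DU.
  have [n [a aP]] := denominators (fun i => rst E (c i)) U_aff (erefl E).
  exists (g ^+ n); last exact: unit_atXn.
  exists a; have IZ : oI E X0 `<=` Z by exact: oIS.
  have IE : oI E X0 `<=` E by exact: oIl.
  (* By integrality the identity over [Z] may be tested on the nonempty open subset [oI E X0], where
     the denominators of [c] are powers of [g]. *)
  apply: (rst_inj X_sch X_int IZ); first by apply: opens_meet => //; exists x.
  rewrite rstM rst_rst // rst_comb //; last exact: oIS.
  have IW : oI E X0 `<=` oI W X0 by exact: oIS.
  rewrite -(rst_rst b IW); last exact: oIS.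
  rewrite bc rst_comb // -(comb_rst f c IE gW) -(rst_rst _ IE EU) -combZ.
  by rewrite -(comb_rst f a IE EU); apply: eq_bigr => i _; rewrite aP.
by exists n, c.
Qed.

Lemma loc_gen_affine1 U (b : sec X (oI U X0)) : affine U -> loc_gen f b ->
  exists c : 'I_d -> sec X U, b = comb f (oI U X0) c.
Proof.
move=> U_aff b_gen.
have [|n [c]] := loc_gen_affine (h := 1) U_aff _ b_gen.
  by apply: opens_eq => x; split=> [/unit_at1|/unit_at_dom].
by rewrite expr1n rst1 // mul1r => ->; exists c.
Qed.

(** On an affine open set the [f i] generate all sections by [loc_gen_affine1], and [loc_gen_affine]
    clears the denominators of sections over a basic open set. *)
Lemma generated_coherent : coherent (generated_sheaf f).
Proof.
move=> x; have [U [U_aff Ux _]] := @affine_nbhd _ _ (otop X) x X_sch I.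
exists U; split=> //.
  exists d, (fun i => gmk (loc_gen_comb f (fun j => (j == i)%:R : sec X U))).
  move=> m; have [c mc] := loc_gen_affine1 U_aff (gvalP m).
  exists c; apply: gval_inj; rewrite mc.
  have gval_sum (F : 'I_d -> gen_sec f U) :
      gval (\sum_i F i) = \sum_i gval (F i).
    by apply: (big_morph (@gval _ _ _ _ f U)).
  rewrite [RHS]gval_sum; apply: eq_bigr => i _.
  by rewrite [RHS]gvalZ gmkK comb_delta.
move=> h; set D := basic_open h; set DU : D `<=` U := @basic_open_sub _ _ _ h.
split=> [m m0|b].
  have gm0 : rst (oI D X0) (gval m) = 0.
    by have := congr1 (@gval _ _ _ _ f D) m0.
  (* If [D] is nonempty, injectivity of restriction makes [m] itself 0; if it is empty, [h] is
     nilpotent. *)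
  have [D0|D0] := pselect (D !=set0).
    exists 0%N; apply: gval_inj; rewrite [LHS]gvalZ.
    suff -> : gval m = 0 by rewrite mulr0.
    by apply: (rst_eq0 X_sch X_int _ _ gm0); [exact: oIS|exact: opens_meet].
  have [|n] := affine_loc0 (f := h) (a := 1) U_aff (erefl D).
    exact: sec_empty.
  rewrite mulr1 => hn; exists n; apply: gval_inj.
  by rewrite [LHS]gvalZ hn raddf0 mul0r.
have [n [c bc]] := loc_gen_affine U_aff (erefl D) (gvalP b).
exists n, (gmk (loc_gen_comb f c)); apply: gval_inj.
rewrite [LHS]gvalZ [RHS]gval_res gmkK rst_comb //; last exact: oIS.
by rewrite -(rstE DU) rst_rst // bc.
Qed.

(** Where [f i0] is invertible, it alone is a frame of the generated sheaf. *)
Lemma generated_rank1 (i0 : 'I_d) : f i0 != 0 -> has_rank (generated_sheaf f) 1.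
Proof.
move=> f0; pose U := basic_open (f i0).
have U0 : U !=set0 by exact: basic_open_neq0.
have UX0 : U `<=` X0 by exact: basic_open_sub.
have [g fg] : exists g, rst U (f i0) * g = 1.
  by apply: unit_sec => x Ux; apply/unit_at_rst.
pose e := gmk (loc_gen_comb f (fun j => (j == i0)%:R : sec X U)).
have eE : gval e = rst _ (f i0) by rewrite gmkK comb_delta.
exists U, (fun=> e); split=> // [V m V0|V VU a V0].
  pose W := oI V U; have WV : W `<=` V by exact: oIl.
  have WU : W `<=` U by exact: oIr.
  have WX0 := subset_trans WU UX0.
  exists W, WU, WV, (fun=> rst W (gval m) * rst W g).
  split; first exact: opens_meet.
  rewrite big_ord1; apply: gval_inj.
  have ZW : oI W X0 `<=` W by exact: oIl.
  have ZU := subset_trans ZW WU.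
  have WI : W `<=` oI V X0 by exact: sub_oI.
  rewrite [LHS]gval_res [RHS]gvalZ gval_res eE rstM.
  rewrite (rst_rst (gval m) ZW WI) (rst_rst g ZW WU) [X in _ * X]rst_rst;
    [|exact: oIS|by []].
  have := congr1 (rst (oI W X0)) fg.
  rewrite rstM (rst_rst _ ZU UX0) rst1 // => fg1.
  by rewrite mulrAC -mulrA fg1 mulr1.
rewrite big_ord1 => ae; have VX0 := subset_trans VU UX0.
exists V, (@subset_refl _ V); split=> // i; rewrite (ord1 i) -rstE rst_id.
have := congr1 (@gval _ _ _ _ f V) ae.
have ZV : V `<=` oI V X0 by exact: sub_oI.
rewrite [LHS]gvalZ gval_res eE rst_rst //; last exact: oIS.
move=> /(congr1 (rst V)); rewrite rstM !rst_rst // rst_id [RHS]raddf0.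
rewrite -(rst_rst (f i0) VU UX0) => /(congr1 (fun b => b * rst V g)).
by rewrite mul0r -mulrA -rstM fg rst1 // mulr1.
Qed.
End GeneratedSheafTheory.

(** * Pushforward of a generated sheaf *)

Lemma comor_rst (k : fieldType) (X Y : ringed_space k) (f : rs_hom X Y)
    (V V' : opens Y) (a : sec Y V) : V' `<=` V ->
  comor f V' (rst V' a) = rst (preim f V') (comor f V a).
Proof.
move=> V'V; rewrite (rstE V'V) (rstE (preimS (f := f) V'V)).
exact: comor_nat.
Qed.

Section PushforwardGenerated.
Context (k : fieldType) (X Y : ringed_space k) (pi : rs_hom X Y).
Hypotheses (X_sch : is_scheme X) (X_int : integral X).
Hypothesis pi_aff : affine_morphism pi.
Context (X0 : opens X) (X0_neq0 : X0 !=set0) (d : nat) (f : 'I_d -> sec X X0).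
Implicit Types V W : opens Y.

(** With coefficients pulled back from [Y], this is the candidate isomorphism from the free module
    of rank [d] to the pushforward of the generated sheaf. *)
Definition pcomb V (c : 'I_d -> sec Y V) : sec X (oI (preim pi V) X0) :=
  comb f (oI (preim pi V) X0) (fun j => comor pi V (c j)).

(** Under this condition the [O_Y]-span of the [f i] over [V] is already their [O_X]-span. *)
Definition span_stable V : Prop := forall (b : sec X (preim pi V)) i,
  exists c : 'I_d -> sec Y V,
    rst (oI (preim pi V) X0) b * rst (oI (preim pi V) X0) (f i) = pcomb c.

Hypothesis f_span : forall V y, V y ->
  exists W, [/\ affine W, W y, W `<=` V & span_stable W].
Hypothesis f_free : forall V (c : 'I_d -> sec Y V),
  pcomb c = 0 -> forall i, c i = 0.

Lemma pcomb_rst V W (c : 'I_d -> sec Y V) : W `<=` V ->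
  pcomb (fun j => rst W (c j)) = rst (oI (preim pi W) X0) (pcomb c).
Proof.
move=> WV; have WV' := preimS (f := pi) WV.
rewrite rst_comb //; last exact: oIS.
rewrite -(comb_rst f _ (@oIl _ (preim pi W) X0) WV').
by apply: eq_bigr => j _; rewrite comor_rst.
Qed.

Lemma pcombD V (c c' : 'I_d -> sec Y V) :
  pcomb (fun j => c j + c' j) = pcomb c + pcomb c'.
Proof. by rewrite -combD; apply: eq_bigr => j _; rewrite rmorphD. Qed.

Lemma pcombZ V (a : sec Y V) (c : 'I_d -> sec Y V) :
  pcomb (fun j => a * c j) = rst _ (comor pi V a) * pcomb c.
Proof. by rewrite -combZ; apply: eq_bigr => j _; rewrite rmorphM. Qed.

Lemma pcomb_inj V (c c' : 'I_d -> sec Y V) : pcomb c = pcomb c' ->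
  forall j, c j = c' j.
Proof.
move=> cc' j; apply/eqP; rewrite -subr_eq0; apply/eqP.
apply: (f_free (c := fun j => c j - c' j)).
have -> : pcomb (fun j => c j - c' j) = pcomb c + pcomb (fun j => -1 * c' j).
  by rewrite -pcombD; apply: eq_bigr => i _; rewrite mulN1r.
by rewrite pcombZ cc' rmorphN1 raddfN /= rst1 // mulN1r subrr.
Qed.

(** Affineness of [pi] gives coefficients that are functions on the preimage of [V]; stability
    rewrites each summand with coefficients from [Y]. *)
Lemma loc_gen_pcomb V (m : sec X (oI (preim pi V) X0)) : affine V ->
  span_stable V -> loc_gen f m -> exists c : 'I_d -> sec Y V, m = pcomb c.
Proof.
move=> V_aff V_span m_gen.
have [b ->] := loc_gen_affine1 X_sch X_int X0_neq0 (pi_aff V_aff) m_gen.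
have [c bc] := choice (fun i => V_span (b i) i).
exists (fun j => \sum_i c i j); rewrite {1}/comb (eq_bigr _ (fun i _ => bc i)).
rewrite exchange_big; apply: eq_bigr => j _ /=.
by rewrite !raddf_sum /= mulr_suml.
Qed.

(** Freeness makes the coefficients over small affine open sets unique, so they glue on [Y], one
    index [j] at a time. *)
Lemma gen_pcomb V (m : gen_sec f (preim pi V)) :
  exists c : 'I_d -> sec Y V, gval m = pcomb c.
Proof.
pose P W (c : 'I_d -> sec Y W) :=
  rst (oI (preim pi W) X0) (gval m) = pcomb c.
have P_rst W W' (c : 'I_d -> sec Y W) : W `<=` V -> W' `<=` W ->
    P W c -> P W' (fun j => rst W' (c j)).
  move=> WV W'W Pc; rewrite /P pcomb_rst // -Pc rst_rst //; apply: oIS => //;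
  exact: preimS.
have P_cov y : V y -> exists W, [/\ W `<=` V, W y & exists c, P W c].
  move=> /f_span[W [W_aff Wy WV W_span]]; exists W; split=> //.
  apply: loc_gen_pcomb => //; apply: loc_gen_rst; first exact: preimS.
  exact: gvalP.
have glue j : exists t : sec Y V, forall W (c : 'I_d -> sec Y W),
    W `<=` V -> P W c -> rst W t = c j.
  have [W W' g WV W'W [c Pc <-]|W _ _ _ [c Pc <-] [c' Pc' <-]|y Vy|t tP] :=
    @sec_glue _ Y V (fun W g => exists2 c, P W c & c j = g).
  - by exists (fun j => rst W' (c j)); first exact: P_rst Pc.
  - by apply: pcomb_inj; rewrite -Pc -Pc'.
  - have [W [WV Wy [c Pc]]] := P_cov y Vy.
    by exists W; split=> //; exists (c j), c.
  by exists t => W c WV Pc; apply: tP => //; exists c.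
have [t tP] := choice glue; exists t.
apply: sec_ext => x [Vx X0x]; have [W [WV Wx [c Pc]]] := P_cov _ Vx.
exists (oI (preim pi W) X0); split=> //.
  by apply: oIS => //; exact: preimS.
by rewrite -pcomb_rst // Pc; apply: eq_bigr => j _; rewrite (tP j W c).
Qed.

(** The coefficients are picked by choice; their uniqueness then gives linearity and compatibility
    with restriction. *)
Definition pcoords V (m : msec (pushforward pi (generated_sheaf f)) V) :
    msec (free_mod Y d) V :=
  \row_j projT1 (cid (gen_pcomb m)) j.

Lemma pcoordsK V (m : msec (pushforward pi (generated_sheaf f)) V) :
  pcomb (fun j => pcoords m 0 j) = gval m.
Proof.
rewrite (projT2 (cid (gen_pcomb m))).
by apply: eq_bigr => j _; rewrite mxE.
Qed.

Lemma pcoords_uniq V (m : msec (pushforward pi (generated_sheaf f)) V)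
  (c : 'rV_d) : pcomb (fun j => c 0 j) = gval m -> pcoords m = c.
Proof.
rewrite -pcoordsK => cm; apply/rowP => j; apply: esym.
exact: (pcomb_inj cm).
Qed.

Lemma pcoords_linear V : linear (@pcoords V).
Proof.
move=> a m m'; apply: pcoords_uniq.
rewrite [RHS]gvalD gvalZ -!pcoordsK -pcombZ -pcombD.
by apply: eq_bigr => j _; rewrite !mxE.
Qed.

HB.instance Definition _ V :=
  GRing.isLinear.Build (sec Y V) (msec (pushforward pi (generated_sheaf f)) V)
    (msec (free_mod Y d) V) _ (@pcoords V) (@pcoords_linear V).

Lemma pushforward_generated :
  mod_iso (pushforward pi (generated_sheaf f)) (free_mod Y d).
Proof.
have pcoords_nat V W (WV : W `<=` V)
    (m : msec (pushforward pi (generated_sheaf f)) V) :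
    pcoords (mres WV m) = mres WV (pcoords m).
  apply: pcoords_uniq; rewrite [RHS]gval_res -pcoordsK -pcomb_rst //.
  by apply: eq_bigr => j _; rewrite [in RHS](rstE WV) mxE.
exists (MHom (mfun := fun V => @pcoords V) pcoords_nat) => V.
pose row_comb (c : msec (free_mod Y d) V) :
    msec (pushforward pi (generated_sheaf f)) V :=
  gmk (loc_gen_comb f (fun j => comor pi V (c 0 j))).
exists row_comb => [m|c]; last exact: pcoords_uniq.
by apply: gval_inj; rewrite gmkK; exact: pcoordsK.
Qed.
End PushforwardGenerated.

(** * Line bundles and the cyclic equation *)

Section Frames.
Context (k : fieldType) (Y : ringed_space k) (L : modsheaf Y).
Implicit Types U V W : opens Y.

Lemma mres_mres U V W (VU : V `<=` U) (WV : W `<=` V) (WU : W `<=` U)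
  (m : msec L U) : mres WV (mres VU m) = mres WU m.
Proof. by have [_ ->] := mres_sheaf L. Qed.

Lemma mres_id U (UU : U `<=` U) (m : msec L U) : mres UU m = m.
Proof. by have [->] := mres_sheaf L. Qed.

Lemma frame_mres V W (WV : W `<=` V) (e : msec L V) :
  is_frame e -> is_frame (mres WV e).
Proof.
move=> he Z ZW m; have [a [ma a_uniq]] := he Z (subset_trans ZW WV) m.
exists a; split=> [|b]; rewrite (mres_mres _ _ (subset_trans ZW WV)) //.
exact: a_uniq.
Qed.

Lemma frame_inj V W (WV : W `<=` V) (e : msec L V) (a b : sec Y W) :
  is_frame e -> a *: mres WV e = b *: mres WV e -> a = b.
Proof.
move=> he ab; have [c [_ c_uniq]] := he W WV (a *: mres WV e).
by rewrite -(c_uniq a) // -(c_uniq b).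
Qed.

Lemma msec_eq0 U (m : msec L U) :
  (forall x, U x -> exists V (VU : V `<=` U), V x /\ mres VU m = 0) -> m = 0.
Proof.
move=> m0; have [_ _ glue] := mres_sheaf L.
pose I := {V : opens Y | V `<=` U /\ forall VU : V `<=` U, mres VU m = 0}.
pose V (i : I) := sval i.
have VU i : V i `<=` U by have [] := svalP i.
have [x|i j W Wi Wj|t [_ t_uniq]] := glue U I V VU _ (fun=> 0).
- move=> /m0[W [WU [Wx mW]]].
  have mW' (WU' : W `<=` U) : mres WU' m = 0.
    by rewrite (Prop_irrelevance WU' WU).
  by exists (exist _ W (conj WU mW')).
- by rewrite !raddf0.
rewrite -(t_uniq m) ?(t_uniq 0) // => i; first by rewrite raddf0.
by have [_] := svalP i; apply.
Qed.

(** In a local frame the section becomes a function, which is 0 because it is 0 on the overlap with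
    the nonempty [V]. *)
Lemma line_bundle_eq0 (Y_sch : is_scheme Y) (Y_int : integral Y) U V
    (VU : V `<=` U) (m : msec L U) :
  line_bundle L -> V !=set0 -> mres VU m = 0 -> m = 0.
Proof.
move=> L_line V0 mV; apply: msec_eq0 => x Ux.
have [V' [e [V'x he]]] := L_line x; pose W := oI U V'.
have WU : W `<=` U by exact: oIl.
have WV' : W `<=` V' by exact: oIr.
have [b [mb _]] := he W WV' (mres WU m).
exists W, WU; split=> //; rewrite mb.
suff -> : b = 0 by rewrite scale0r.
have ZW := @oIl _ W V; have ZV := @oIr _ W V.
apply: (rst_eq0 Y_sch Y_int ZW); first by apply: opens_meet => //; exists x.
rewrite (rstE ZW); apply: (frame_inj (WV := subset_trans ZW WV') he).
rewrite scale0r -(mres_mres WV' ZW) -mresZ -mb.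
by rewrite (mres_mres WU ZW (subset_trans ZV VU)) -(mres_mres VU ZV) mV raddf0.
Qed.

Section Multilinear.
Context (d : nat) (N : modsheaf Y) (nu : multilinear d L N).

Lemma upd_id (T : Type) (v : 'I_d -> T) i : upd v i (v i) = v.
Proof. by apply/funext => j; rewrite /upd; case: eqP => // ->. Qed.

Lemma mlfun0 U (v : 'I_d -> msec L U) i : v i = 0 -> mlfun nu v = 0.
Proof.
move=> vi; have := mlfun_lin nu v i (-1) 0 0.
by rewrite scaler0 addr0 scaleN1r addNr -vi upd_id.
Qed.

Lemma mlfunZ U (v : 'I_d -> msec L U) i a x :
  mlfun nu (upd v i (a *: x)) = a *: mlfun nu (upd v i x).
Proof.
have := mlfun_lin nu v i a x 0; rewrite addr0 => ->.
by rewrite [X in _ + X](@mlfun0 _ _ i) ?addr0 // /upd eqxx.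
Qed.

Lemma mlfun_scale U (b : 'I_d -> sec Y U) (e : msec L U) :
  mlfun nu (fun i => b i *: e) = (\prod_i b i) *: mlfun nu (fun=> e).
Proof.
(* Slots listed in [r] carry their scalar, the others do not; the scalars are pulled out by
   induction on [r]. *)
pose v (r : seq 'I_d) i := if i \in r then b i *: e else e.
have vE r : uniq r ->
    mlfun nu (v r) = (\prod_(i <- r) b i) *: mlfun nu (fun=> e).
  elim: r => [|i r IHr] /=; first by rewrite big_nil scale1r.
  move=> /andP[ir /IHr vr]; rewrite big_cons -scalerA -vr.
  have -> : v (i :: r) = upd (v r) i (b i *: e).
    by apply/funext => j; rewrite /v /upd inE; case: eqP => // ->.
  rewrite mlfunZ -[in RHS](upd_id (v r) i); congr (_ *: mlfun nu (upd _ _ _)).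
  by rewrite /v (negPf ir).
rewrite -vE ?index_enum_uniq //; congr mlfun.
by apply/funext => i; rewrite /v mem_index_enum.
Qed.
End Multilinear.
End Frames.

(* Comparing coefficients of t^(m + d) gives h_m = sigma h_(m + d), so that
   h = 0 by descending induction on m. *)
Lemma monic_free (R S : comPzRingType) (p : {rmorphism R -> S}) (t : S)
    (sigma : R) (d n : nat) (c h : nat -> R) :
  (forall N (e : nat -> R), \sum_(i < N) p (e i) * t ^+ i = 0 ->
     forall i, (i < N)%N -> e i = 0) ->
  \sum_(i < d) p (c i) * t ^+ i
    = (\sum_(i < n) p (h i) * t ^+ i) * (t ^+ d - p sigma) ->
  forall i, (i < d)%N -> c i = 0.
Proof.
move=> t_free ch i id; have d0 : (0 < d)%N by exact: leq_ltn_trans id.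
pose g j := if (j < n)%N then h j else 0.
have g_ge j : (n <= j)%N -> g j = 0 by rewrite /g ltnNge => ->.
pose e j := (if (j < d)%N then c j else - g (j - d)%N) + sigma * g j.
have e0 j : (j < d + n)%N -> e j = 0.
  apply: t_free; rewrite /e.
  under eq_bigr do rewrite rmorphD mulrDl rmorphM -mulrA.
  rewrite big_split /= -mulr_sumr big_split_ord /=.
  have -> : \sum_(i < d + n) p (g i) * t ^+ i = \sum_(i < n) p (h i) * t ^+ i.
    rewrite addnC big_split_ord /= [X in _ + X]big1 ?addr0 => [|l _].
      by apply: eq_bigr => l _; rewrite /g ltn_ord.
    by rewrite g_ge ?leq_addr // rmorph0 mul0r.
  have -> : \sum_(j < d) p (if (j < d)%N then c j else - g (j - d)%N) * t ^+ j
      = \sum_(j < d) p (c j) * t ^+ j.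
    by apply: eq_bigr => l _; rewrite ltn_ord.
  have -> : \sum_(j < n) p (if (d + j < d)%N then c (d + j)%N
      else - g (d + j - d)%N) * t ^+ (d + j)
      = - (t ^+ d * \sum_(j < n) p (h j) * t ^+ j).
    rewrite mulr_sumr -sumrN; apply: eq_bigr => l _.
    by rewrite ltnNge leq_addr addKn /g ltn_ord rmorphN exprD; ring.
  by rewrite ch; ring.
have g0 j : g j = 0.
  have [m] := ubnP (n - j); elim: m j => // m IHm j nj.
  have [/g_ge//|jn] := leqP n j.
  have := e0 (d + j)%N; rewrite ltn_add2l => /(_ jn).
  rewrite /e ltnNge leq_addr addKn /= [g (d + j)%N]IHm ?mulr0 ?addr0.
    by move=> /eqP; rewrite oppr_eq0 => /eqP.
  by rewrite -ltnS; apply: leq_trans nj; lia.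
by have := e0 i (ltn_addr n id); rewrite /e id g0 mulr0 addr0.
Qed.

(** [tau] is the tautological coordinate restricted to [X]. Over an affine [V] with a frame, [O_X]
    is the quotient of [O_Y[t]] by [t^d - sigma]: surjectivity gives generation by the powers of
    [t], and the kernel gives both the relation and, through [monic_free], the independence of the
    first [d] powers. *)
Lemma cyclic_coordinate (k : fieldType) (X Y : ringed_space k) (d : nat)
    (L : modsheaf Y) (Ld : tensor_power d L) (s : msec Ld (otop Y))
    (pi : rs_hom X Y) :
  cyclic_equation s pi ->
  exists tau : forall (V : opens Y) (e : msec L V),
      is_frame e -> sec X (preim pi V),
  [/\ forall (V V' W : opens Y) (e : msec L V) (e' : msec L V')
        (he : is_frame e) (he' : is_frame e') (WV : W `<=` V) (WV' : W `<=` V')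
        (g : sec Y W), mres WV' e' = g *: mres WV e ->
        rst (preim pi W) (tau V e he)
        = comor pi W g * rst (preim pi W) (tau V' e' he'),
      forall (V : opens Y) (e : msec L V) (he : is_frame e), affine V ->
        forall b, exists n (c : 'I_n -> sec Y V),
          b = \sum_(i < n) comor pi V (c i) * tau V e he ^+ i
    & forall (V : opens Y) (e : msec L V) (he : is_frame e) (sigma : sec Y V),
        affine V ->
        mres (@subsetT _ V : V `<=` otop Y) s
        = sigma *: mlfun (tens Ld) (fun=> e) ->
        tau V e he ^+ d = comor pi V sigma /\
        forall c : nat -> sec Y V,
          \sum_(i < d) comor pi V (c i) * tau V e he ^+ i = 0 ->
          forall i, (i < d)%N -> c i = 0].
Proof.
move=> [T [p [tot [i [T_sch i_closed [ipE ip_comor] i_ker]]]]].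
(* The two preimages have the same points but are different terms, so restrictions pass between
   them. *)
have BA V : preim pi V `<=` preim i (preim p V) by move=> x; rewrite /= ipE.
have AB V : preim i (preim p V) `<=` preim pi V by move=> x; rewrite /= ipE.
pose phi V : {rmorphism sec T (preim p V) -> sec X (preim pi V)} :=
  res (BA V) \o comor i (preim p V).
have phiE V b : phi V b = rst (preim pi V) (comor i _ b).
  by rewrite (rstE (BA V)).
have phi_p V a : phi V (comor p V a) = comor pi V a.
  by have := ip_comor V a _ (@subset_refl _ _) (BA V); rewrite -rstE rst_id.
have phi_surj V : affine V -> forall b, exists a, phi V a = b.
  move=> V_aff b; have [_ i_surj] := i_closed.
  have [a ab] := i_surj _ (total_affine tot V_aff) (rst _ b).
  by exists a; rewrite phiE ab rst_rst // rst_id.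
have phi_eq0 V a : phi V a = 0 -> comor i _ a = 0.
  rewrite phiE => /(congr1 (rst (preim i (preim p V)))).
  by rewrite rst_rst // rst_id raddf0.
exists (fun V e (he : is_frame e) => phi V (Defs.coord tot he)); split.
- move=> V V' W e e' he he' WV WV' g ee'.
  have phi_rst (U : opens Y) (WU : W `<=` U) a :
      rst (preim pi W) (phi U a) = phi W (res (preimS (f := p) WU) a).
    rewrite !phiE -rstE comor_rst; last exact: preimS.
    by rewrite !rst_rst //; do ?[exact: preimS]; apply: preimS; exact: preimS.
  rewrite (phi_rst _ WV) (phi_rst _ WV').
  by rewrite (coordE tot he he' ee') rmorphM phi_p.
- move=> V e he V_aff b; have [a <-] := phi_surj V V_aff b.
  have [n [c ->]] := total_gen tot he V_aff a; exists n, c.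
  by rewrite rmorph_sum; apply: eq_bigr => j _; rewrite rmorphM rmorphXn phi_p.
move=> V e he sigma V_aff s_sigma.
have ker := i_ker V e he sigma V_aff s_sigma.
split=> [|c].
  have phi0 : phi V (Defs.coord tot he ^+ d - comor p V sigma) = 0.
    rewrite phiE (proj2 (ker _)) ?raddf0 //.
    by exists 1; rewrite mul1r.
  move: phi0; rewrite rmorphB rmorphXn phi_p => /eqP.
  by rewrite subr_eq0 => /eqP.
have -> : \sum_(i < d) comor pi V (c i) * phi V (Defs.coord tot he) ^+ i
    = phi V (\sum_(i < d) comor p V (c i) * Defs.coord tot he ^+ i).
  by rewrite rmorph_sum; apply: eq_bigr => j _; rewrite rmorphM rmorphXn phi_p.
move=> /phi_eq0/ker[h ch]; have [n [hc hE]] := total_gen tot he V_aff h.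
pose g j := if insub j is Some j' then hc j' else 0.
apply: (monic_free (p := comor p V) (t := Defs.coord tot he) (sigma := sigma)
  (n := n) (h := g)) => [N b b0 j jN|].
  exact: (total_free (c := fun j : 'I_N => b j) V_aff b0 (Ordinal jN)).
rewrite ch hE; congr (_ * _); apply: eq_bigr => j _.
by rewrite /g insubT //= => jn; congr (comor p V (hc _) * _); exact: val_inj.
Qed.

(** * The sheaf generated by the [f i] and its freeness over [Y] *)

Theorem corollary4p9 (k : closedFieldType) (k_char0 : [pchar k] =i pred0)
    (Y : ringed_space k) (Y_proj : projective_variety Y)
    (L : modsheaf Y) (L_line : line_bundle L)
    (d : nat) (d_gt0 : (0 < d)%N) (Ld : tensor_power d L)
    (s : msec Ld (otop Y)) (s_neq0 : s != 0)
    (a : 'I_d -> msec L (otop Y)) (s_prod : s = mlfun (tens Ld) a)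
    (X : ringed_space k) (X_proj : projective_variety X)
    (pi : rs_hom X Y) (pi_cover : standard_cyclic_cover s pi) :
  exists E : modsheaf X, relatively_ulrich pi E /\ has_rank E 1.
Proof.
have [Y_sch Y_int _] := Y_proj; have [X_sch X_int _] := X_proj.
have [[pi_aff _] [_ [_ _ [pi_surj _ _ _] _]] _ pi_eq] := pi_cover.
have [tau [tau_trans tau_gen tau_eq]] := cyclic_coordinate pi_eq.
pose aV (V : opens Y) j := mres (@subsetT _ V : V `<=` otop Y) (a j).
have aV_res (V W : opens Y) (WV : W `<=` V) j : mres WV (aV V j) = aV W j.
  exact: mres_mres.
have s_frame (V : opens Y) (e : msec L V) (b : 'I_d -> sec Y V) :
    (forall j, aV V j = b j *: e) ->
    mres (@subsetT _ V : V `<=` otop Y) s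
    = (\prod_j b j) *: mlfun (tens Ld) (fun=> e).
  move=> ab; rewrite s_prod -mlfun_nat -mlfun_scale; congr mlfun.
  by apply/funext => j; exact: ab.
have frame_coef (V : opens Y) (e : msec L V) : is_frame e ->
    exists b : 'I_d -> sec Y V, forall j, aV V j = b j *: e.
  move=> he; suff ab j : exists b, aV V j = b *: e.
    by have [b bP] := choice ab; exists b.
  have [b [ab _]] := he V (@subset_refl _ V) (aV V j).
  by exists b; rewrite ab mres_id.
have [[y0 _] _] := Y_int.
have [V1 [e1 [V1y he1]]] := L_line y0.
have [V0 [V0_aff V0y V0V1]] := affine_nbhd Y_sch V1y.
have V0_neq0 : V0 !=set0 by exists y0.
pose e0 := mres V0V1 e1; have he0 : is_frame e0 by exact: frame_mres.
have [al alP] := frame_coef V0 e0 he0.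
(* If [al j] were 0, then [a j] would vanish on the nonempty [V0], hence everywhere, and [s] would
   be 0. *)
have al_neq0 j : al j != 0.
  apply: contra_neq s_neq0 => al0; rewrite s_prod.
  apply: (@mlfun0 _ _ _ _ _ _ _ _ j).
  have aj0 : aV V0 j = 0 by rewrite alP al0 scale0r.
  exact: line_bundle_eq0 L_line V0_neq0 aj0.
pose X0 := preim pi V0; pose t0 : sec X X0 := tau V0 e0 he0.
have X0_neq0 : X0 !=set0 by have [x xy] := pi_surj y0; exists x; rewrite /= xy.
pose q (i : 'I_d) := \prod_(j < d | (i < j)%N) al j.
pose f (i : 'I_d) : sec X X0 := t0 ^+ i * comor pi V0 (q i).
have t0d : t0 ^+ d = comor pi V0 (\prod_j al j).
  by have [->] := tau_eq V0 e0 he0 _ V0_aff (s_frame V0 e0 al alP).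
have f_shift i : t0 * f i = comor pi V0 (al (ordS i)) * f (ordS i).
  (* For [i + 1 < d] the factor at [i + 1] splits off from [q i]. At the last index [ordS] wraps
     around to 0: there [q i = 1], and the cyclic equation turns [t0 ^+ d] into the full product. *)
  rewrite /f mulrA -exprS; have [id|id] := ltnP i.+1 d.
    have Si : ordS i = i.+1 :> nat by rewrite /= modn_small.
    rewrite Si mulrCA -rmorphM; congr (_ * comor pi V0 _).
    rewrite /q (bigD1 (ordS i)) ?Si //=; congr (_ * _); apply: eq_bigl => j.
    by rewrite -val_eqE /= modn_small // [RHS]ltn_neqAle andbC eq_sym.
  have iS : i.+1 = d by apply/eqP; rewrite eqn_leq id ltn_ord.
  have Si : ordS i = 0%N :> nat by rewrite /= iS modnn.
  rewrite Si mulrCA expr0 mul1r -rmorphM iS t0d.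
  have -> : q i = 1 by apply: big1 => j; rewrite ltnNge -ltnS iS ltn_ord.
  rewrite rmorph1 mulr1.
  congr (comor pi V0 _); rewrite (bigD1 (ordS i)) //=; congr (_ * _).
  by apply: eq_bigl => j; rewrite Si lt0n -Si.
have f_span (V : opens Y) y : V y ->
    exists W, [/\ affine W, W y, W `<=` V & span_stable pi f W].
  move=> Vy; have [V' [e' [V'y he']]] := L_line y.
  (* [W] is affine and carries a frame of [L], so the powers of its coordinate generate [O_X] over
     it. *)
  have [W [W_aff Wy WVV']] := affine_nbhd Y_sch (conj Vy V'y : oI V V' y).
  have WV := subset_trans WVV' (@oIl _ V V').
  have WV' := subset_trans WVV' (@oIr _ V V').
  exists W; split=> //.
  pose e := mres WV' e'; have he : is_frame e by exact: frame_mres.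
  have [be beP] := frame_coef W e he.
  pose Z := oI (preim pi W) X0.
  have ZW : Z `<=` preim pi W by exact: oIl.
  have ZX0 : Z `<=` X0 by exact: oIr.
  pose W0 := oI W V0; have W0W : W0 `<=` W by exact: oIl.
  have W0V0 : W0 `<=` V0 by exact: oIr.
  have ZW0 : Z `<=` preim pi W0 by [].
  (* [g] is the transition function, [e0 = g e]. Passing to [e] multiplies both the coordinate and
     the coefficients of the [a j] by [g], so the shift relation keeps its form. *)
  have [g [eg _]] := he W0 W0W (mres W0V0 e0).
  have tau_g := tau_trans W V0 W0 e e0 he he0 W0W W0V0 g eg.
  have be_g j : rst W0 (be j) = rst W0 (al j) * g.
    apply: (frame_inj (WV := W0W) he).
    rewrite (rstE W0W) (rstE W0V0) -scalerA -eg -!mresZ -beP -alP.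
    by rewrite !aV_res.
  pose t := tau W e he.
  have t_shift i :
      rst Z t * rst Z (f i)
      = rst Z (comor pi W (be (ordS i))) * rst Z (f (ordS i)).
    rewrite -(rst_rst t ZW0 (preimS W0W)) tau_g rstM.
    rewrite -(rst_rst (comor pi W _) ZW0 (preimS W0W)) -comor_rst // be_g.
    rewrite rmorphM rstM (comor_rst _ _ W0V0).
    rewrite !(rst_rst _ ZW0 (preimS W0V0)) -mulrA.
    have := congr1 (rst Z) (f_shift i); rewrite !rstM => ->.
    by rewrite mulrCA mulrA.
  (* Each factor [t] advances the index cyclically by one and leaves a coefficient from [Y]. *)
  have pow n : forall i, exists c : 'I_d -> sec Y W,
      rst Z (t ^+ n) * rst Z (f i) = pcomb pi f c.
    elim: n => [|n IHn] i.
      exists (fun j => (j == i)%:R); rewrite expr0 rst1 // mul1r.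
      rewrite -(comb_delta f i ZW); apply: eq_bigr => j _.
      by rewrite rmorph_nat.
    have [c nc] := IHn (ordS i); exists (fun j => be (ordS i) * c j).
    by rewrite pcombZ -nc exprSr rstM -mulrA t_shift; ring.
  move=> b i; have [n [c ->]] := tau_gen W e he W_aff b.
  have [c' cc'] := choice (fun m : 'I_n => pow m i).
  exists (fun j => \sum_(m < n) c m * c' m j).
  rewrite raddf_sum mulr_suml /=.
  under eq_bigr => m _ do rewrite rstM -mulrA cc' -pcombZ.
  rewrite /pcomb /comb exchange_big; apply: eq_bigr => j _ /=.
  by rewrite !raddf_sum /= mulr_suml.
have f_free (V : opens Y) (c : 'I_d -> sec Y V) :
    pcomb pi f c = 0 -> forall i, c i = 0.
  move=> c0 i; have [V_neq0|] := pselect (V !=set0); last exact: sec_empty.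
  (* A nonempty [V] meets [V0]; vanishing may be tested on an affine open set inside both. *)
  have [y [Vy V0y']] := opens_meet Y_int V_neq0 V0_neq0.
  have [W [W_aff Wy WVV0]] := affine_nbhd Y_sch (conj Vy V0y' : oI V V0 y).
  have W_neq0 : W !=set0 by exists y.
  have WV := subset_trans WVV0 (@oIl _ V V0).
  have WV0 := subset_trans WVV0 (@oIr _ V V0).
  pose e := mres WV0 e0; have he : is_frame e by exact: frame_mres.
  pose t := tau W e he.
  have tE : t = rst (preim pi W) t0.
    have := tau_trans W V0 W e e0 he he0 (@subset_refl _ W) WV0 1.
    by rewrite mres_id scale1r rmorph1 mul1r rst_id; exact.
  have alW j : aV W j = rst W (al j) *: e.
    by rewrite (rstE WV0) -mresZ -alP aV_res.
  have [_ t_free] := tau_eq W e he _ W_aff (s_frame W e _ alW).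
  have q_neq0 : rst W (q i) != 0.
    apply/eqP => /(rst_eq0 Y_sch Y_int WV0 W_neq0)/eqP; apply/negP.
    rewrite /q; elim/big_ind: _ => [|u v u0 v0|//].
      exact: sec1_neq0.
    by apply: contra_neq u0 => uv; apply: (sec_mulIf Y_int v0); rewrite mulrC.
  apply: (rst_eq0 Y_sch Y_int WV W_neq0).
  apply: (sec_mulIf Y_int q_neq0).
  (* Over [W] the combination is a polynomial in [t] of degree below [d] with coefficients
     [q j * c j], extended by 0 to all [j]. Independence of the powers of [t] kills them, and the
     nonzero [q i] cancels. *)
  pose u (j : nat) : sec Y W :=
    if insub j is Some j' then rst W (q j') * rst W (c j') else 0.
  have uE (j : 'I_d) : u j = rst W (q j) * rst W (c j) by rewrite /u valK.
  rewrite -uE; apply: t_free => //.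
  have WX0 : preim pi W `<=` X0 by exact: preimS.
  have WI : preim pi W `<=` oI (preim pi V) X0.
    by apply: sub_oI => //; exact: preimS.
  transitivity (rst (preim pi W) (pcomb pi f c)); last by rewrite c0 raddf0.
  rewrite /pcomb rst_comb //; apply: eq_bigr => j _.
  rewrite uE rmorphM !comor_rst // /f rstM rstXn // -/t tE.
  by rewrite -mulrA mulrC -!mulrA; congr (_ * _); ring.
pose i0 := Ordinal d_gt0.
have f_neq0 : f i0 != 0.
  (* If [f i0] were 0, the combination with the single coefficient 1 at [i0] would vanish, and
     freeness would give [1 = 0] over [V0]. *)
  apply/eqP => fi0; have /eqP := sec1_neq0 Y_int V0_neq0; apply.
  have := f_free V0 (fun j => (j == i0)%:R) _ i0; rewrite eqxx; apply.
  have IX0 : oI (preim pi V0) X0 `<=` preim pi V0 by exact: oIl.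
  transitivity (rst (oI (preim pi V0) X0) (f i0)); last by rewrite fi0 raddf0.
  rewrite -(comb_delta f _ IX0); apply: eq_bigr => j _.
  by rewrite rmorph_nat.
exists (generated_sheaf f); split; last exact: generated_rank1 f_neq0.
split; first exact: generated_coherent.
by exists d; split=> //; exact: pushforward_generated.
Qed.
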